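(* Let $A, B$ be two finite sets of lines in $\mathbb{R}^2$ such that $A \cup B$ is in general position, and let $r$ be a fixed positive integer. Then there is a convex partition $(C_1, \ldots, C_r)$ of $\mathbb{R}^2$ into $r$ parts such that for all $j \in \{1, \ldots, r\}$ there exist sets $A_j \subset A$, $B_j \subset B$ such that $I(A_j) \subset C_j$, $I(B_j) \subset C_j$ and $$|A_j| \ge r^{\ln (2/3)} |A|^{1/r}-2r, \qquad |B_j| \ge r^{\ln (2/3)} |B|^{1/r}-2r.$$
   Context: A convex partition of $\mathbb{R}^2$ into $r$ parts is a family of closed convex sets $C_1,\ldots,C_r\subset\mathbb{R}^2$ whose union is $\mathbb{R}^2$ and whose interiors are pairwise disjoint. For a set $L$ of lines in the plane, no two of which are parallel, $I(L)$ denotes the set of pairwise intersection points of (distinct) lines of $L$ (so $I(L)=\emptyset$ if $|L|\le 1$). A set $L$ of lines in the plane is in general position if: (i) no two lines in $L$ are parallel; (ii) no three lines in $L$ are concurrent; (iii) if three points in $I(L)$ are collinear, they belong to the same line in $L$. Here $\ln$ is the natural logarithm. *)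

(* Defs.v *)
From HB Require Import structures.
From mathcomp Require Import all_boot all_order all_algebra finmap.
From mathcomp Require Import all_classical all_reals all_analysis.

Set Implicit Arguments.
Unset Strict Implicit.
Unset Printing Implicit Defensive.

Import Order.TTheory GRing.Theory Num.Theory.
Import numFieldNormedType.Exports.

Local Open Scope classical_set_scope.
Local Open Scope ring_scope.

Notation plane R := 'rV[R]_2.

Definition line_through (R : realType) (p v : plane R) : set (plane R) :=
  [set p + t *: v | t in [set: R]].

Definition is_line (R : realType) (l : set (plane R)) : Prop :=
  exists p v : plane R, v != 0 /\ l = line_through p v.

(* A line is parallel to itself; [general_position] only tests distinct
   lines. *)
Definition parallel (R : realType) (l m : set (plane R)) : Prop :=
  exists p q v : plane R,
    [/\ v != 0, l = line_through p v & m = line_through q v].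

Definition collinear (R : realType) (x y z : plane R) : Prop :=
  exists l : set (plane R), [/\ is_line l, l x, l y & l z].

(* [{fset set (plane R)}] uses the classical choice structure on
   [set (plane R)]: two lines are equal when they have the same points. *)
Definition line_set (R : realType) (L : {fset set (plane R)}) : Prop :=
  forall l, l \in L -> is_line l.

Definition intersection_points (R : realType) (L : {fset set (plane R)}) :
    set (plane R) :=
  [set x | exists l m, [/\ l \in L, m \in L, l != m, l x & m x]].

(* The three points in the last clause have to be pairwise distinct: two points
   lie on a common line, hence with a repetition the clause would fail for
   almost every L. *)
Definition general_position (R : realType) (L : {fset set (plane R)}) : Prop :=
  [/\ (forall l m, l \in L -> m \in L -> l != m -> ~ parallel l m),
      (forall l m n, l \in L -> m \in L -> n \in L ->
         l != m -> l != n -> m != n -> l `&` m `&` n = set0)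
    & (forall x y z : plane R,
         intersection_points L x -> intersection_points L y ->
         intersection_points L z -> x != y -> x != z -> y != z ->
         collinear x y z -> exists l, [/\ l \in L, l x, l y & l z])].

(* A part may be empty or have empty interior: closed, convex, covering and
   disjoint interiors are the only requirements. *)
Definition convex_partition (R : realType) (r : nat) (C : 'I_r -> set (plane R)) :
    Prop :=
  [/\ (forall j, closed (C j)),
      (forall j, convex_set (C j)),
      \bigcup_(j in [set: 'I_r]) C j = [set: plane R]
    & trivIset [set: 'I_r] (fun j => (C j)°)].

(* Main.v *)
(** Two lines of a family are compared by slope when they cross inside a given
    region.  For a halfplane, and for the wedges of a three-ray fan, this is a
    partial order, so by Mirsky's theorem a family of [n] lines has subfamilies
    of sizes [p], [p'] crossing only in the two sides of a line with
    [p p' >= n - 1], and subfamilies of sizes [p1], [p2], [p3] crossing only in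
    the three parts of a convex fan with [p1 p2 p3 >= n / 2].

    The partition is built recursively as for measures (Bespamyatnikh,
    Kirkpatrick, Snoeyink): either some line splits [r] into [k + (r - k)]
    suitably for both families, or the signs of the defects allow to split
    [r = 1 + l + m] by a fan with a vertical ray.  The fan comes from a
    Sperner-type lemma on a grid of apices: the family [B] determines the two
    other rays (regularized by an inf-convolution, since they jump), the family
    [A] determines the colour, and the mesh tends to zero along an ultrafilter. *)

Require Import Defs.
From HB Require Import structures.
From mathcomp Require Import all_boot all_order all_algebra finmap.
From mathcomp Require Import all_classical all_reals all_analysis.
From mathcomp Require Import ring lra zify.

Set Implicit Arguments.
Unset Strict Implicit.
Unset Printing Implicit Defensive.

Import Order.TTheory GRing.Theory Num.Theory.
Import numFieldNormedType.Exports.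

Local Open Scope classical_set_scope.
Local Open Scope fset_scope.
Local Open Scope ring_scope.

(** * Chains, antichains and rich regions *)

(** Unlike a measure, the size of the largest subfamily crossing only in a region jumps when the
    region moves, and it is not additive: the covering bounds are products. So every step works with
    closed conditions (being rich) and with covering alternatives, never with equalities, and the
    thresholds multiply: for parts [k_i] of [r] their product is the size of the family times the
    product of the [(k_i / r) ^ (- k_i * ln (2 / 3))]. If no line balances a split, the sign says
    that every halfplane rich in [B] is rich in [A]. This enters where a fan degenerates: with the
    apex at minus infinity the left wedge, and with opposite openings the top, is a halfplane. There
    the colouring cannot use [A] directly, and the sign supplies what is missing. *)

Lemma chain_or_antichain (T : choiceType) (R : rel T) (k : nat) (S : {fset T}) :
  (exists c : seq T, [/\ size c = k.+1, {subset c <= S} & sorted R c]) \/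
  (exists E : {fset T}, [/\ E `<=` S, (#|` S| <= k * #|` E|)%N
     & {in E &, forall x y, ~~ R x y}]).
Proof.
elim: k S => [|k IH] S.
  have [->|[x xS]] := fset_0Vmem S.
    by right; exists fset0; rewrite cardfs0.
  by left; exists [:: x]; split=> // y; rewrite inE => /eqP->.
(* Elements without predecessor. A chain outside [E0] extends by a predecessor of its first element;
   otherwise the larger of [E0] and the antichain found outside it serves. *)
pose E0 := [fset x in S | ~~ has (fun y => R y x) S].
have E0S : E0 `<=` S by apply: fset_sub.
have E0P x : x \in E0 -> forall y, y \in S -> ~~ R y x.
  rewrite !inE /= => /andP[_ /hasPn h] y yS.
  exact: h.
have [[[|x c] [//= [sc] cS Rc]]|[E [ES cardE antiE]]] := IH (S `\` E0).
  have := cS x (mem_head _ _).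
  rewrite inE => /andP[xE0 xS].
  move: xE0; rewrite !inE /= xS /= negbK => /hasP[y yS Ryx].
  left; exists [:: y, x & c]; split.
  - by rewrite /= sc.
  - move=> z; rewrite inE => /orP[/eqP->//|zc].
    by have := cS z zc; rewrite inE => /andP[].
  - by rewrite /= Ryx.
have cardS : #|` S| = (#|` E0| + #|` S `\` E0|)%N.
  have := cardfsID E0 S.
  have -> : S `&` E0 = E0 by apply/fsetIidPr.
  by [].
right; case: (leqP #|` E0| #|` E|) => le.
  exists E; split=> //.
    exact: fsubset_trans ES (fsubsetDl _ _).
  by rewrite cardS mulSn leq_add.
exists E0; split=> //.
  rewrite cardS mulSn leq_add2l (leq_trans cardE) // leq_mul2l.
  by rewrite (ltnW le) orbT.
move=> x y xE yE; apply: (E0P y yE).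
exact: (fsubsetP E0S).
Qed.

Definition rich (R : realType) (L : {fset set (plane R)}) (C : set (plane R))
    (a : R) : Prop :=
  exists L' : {fset set (plane R)},
    [/\ L' `<=` L, (intersection_points L' `<=` C)%classic & a <= #|` L'|%:R].

Lemma richS (R : realType) (L : {fset set (plane R)}) (C D : set (plane R))
    (a b : R) :
  (forall q, intersection_points L q -> C q -> D q) -> b <= a ->
  rich L C a -> rich L D b.
Proof.
move=> CD ba [L' [L'L IC aL']]; exists L'; split=> //.
  move=> q qL'; apply: CD; last exact: IC.
  case: qL' => l [m [lL mL lm lq mq]]; exists l, m; split=> //.
    exact: (fsubsetP L'L).
  exact: (fsubsetP L'L).
exact: le_trans aL'.
Qed.

Lemma chain_or_antichain_rich (R : realType) (S : {fset set (plane R)})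
    (r : rel (set (plane R))) (D : set (plane R)) (p p' : R) :
  transitive r -> irreflexive r ->
  {in S &, forall l m, r l m -> forall q, l q -> m q -> D q} ->
  0 < p -> p * p' <= #|` S|%:R ->
  rich S D p \/
  exists E : {fset set (plane R)}, [/\ E `<=` S, p' <= #|` E|%:R
     & {in E &, forall l m, ~~ r l m}].
Proof.
move=> tr ir rD p0 pp'.
(* For the least such [k], a chain has [k + 1 >= p] lines, and [k < p] turns the cardinality bound
   of the antichain into [p']. *)
have ex : exists k : nat, p <= k.+1%:R.
  by exists (Num.bound p); rewrite ltW // (lt_trans (archi_boundP (ltW p0))) ?ltr_nat.
case: (ex_minnP ex) => k pk kmin.
have kp : k%:R < p.
  case: k {pk} kmin => [//|k] kmin.
  by rewrite ltNge; apply/negP => /kmin; rewrite ltnn.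
have [[c [sc cS cr]]|[E [ES cardE antiE]]] := chain_or_antichain r k S.
  left; exists [fset x in c]; split.
  - by apply/fsubsetP => x; rewrite inE => /cS.
  - move=> q [l [m [/[!inE] lc mc lm lq mq]]].
    have := cr; rewrite (sorted_pairwise tr) => /(pairwiseP l) prc.
    have : exists2 i, (i < size c)%N & nth l c i = l.
      by exists (index l c); rewrite ?index_mem ?nth_index.
    move=> [i isz il].
    have : exists2 j, (j < size c)%N & nth l c j = m.
      by exists (index m c); rewrite ?index_mem ?nth_index.
    move=> [j jsz jm].
    case: (ltngtP i j) => ij.
    + by have := prc i j isz jsz ij; rewrite il jm => /rD; apply=> //; exact: cS.
    + by have := prc j i jsz isz ij; rewrite il jm => /rD; apply=> //; exact: cS.
    + by move: lm; rewrite -il -jm ij eqxx.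
  - rewrite (le_trans pk) // ler_nat.
    have uc : uniq c by apply: (sorted_uniq tr ir).
    by rewrite (card_fseq c) undup_id // sc.
right; exists E; split=> //.
rewrite -(ler_pM2l p0) (le_trans pp') //.
apply: (@le_trans _ _ (k%:R * #|` E|%:R)); first by rewrite -natrM ler_nat.
by rewrite ler_wpM2r // ltW.
Qed.

(** * Limits along an ultrafilter *)

Lemma ultra_exists : exists U : set_system nat, UltraFilter U /\ (\oo `<=` U)%classic.
Proof. exact: ultraFilterLemma. Qed.

Lemma ultraU (T : Type) (U : set_system T) (A B : set T) :
  UltraFilter U -> U (A `|` B)%classic -> U A \/ U B.
Proof.
move=> UU UAB; have [UA|UnA] := in_ultra_setVsetC A UU; first by left.
right; apply: filterS (filterI UAB UnA) => x [[Ax|Bx] nAx] //.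
Qed.

Lemma ultra_ex_seq (T : Type) (I : eqType) (U : set_system T) (s : seq I)
    (P : T -> I -> Prop) :
  UltraFilter U -> U [set t | exists2 i, i \in s & P t i] ->
  exists2 i, i \in s & U [set t | P t i].
Proof.
move=> UU; elim: s => [|i s IH].
  by move=> /filter_ex[t [i]].
move=> UP.
have [|UPi|UPs] := @ultraU _ U [set t | P t i] [set t | exists2 i, i \in s & P t i] UU.
- apply: filterS UP => t [j]; rewrite inE => /orP[/eqP->|js] Pj; first by left.
  by right; exists j.
- by exists i; rewrite ?mem_head.
- by have [j js Uj] := IH UPs; exists j => //; rewrite inE js orbT.
Qed.

(** This replaces the extraction of subsequences: all bounded sequences converge along the same
    [U]. *)
Lemma ultra_cvg (R : realType) (U : set_system nat) (u : nat -> R) (M : R) :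
  UltraFilter U -> U [set n | `|u n| <= M] -> exists l : R, u n @[n --> U] --> l.
Proof.
move=> UU uM.
have := @segment_compact R (- M) M; rewrite compact_ultra => /(_ (u @ U)) [].
- split; first exact: fmap_proper_filter.
  move=> G PG UG; apply/seteqP; split=> // A GA.
  have [//|UnA] := in_ultra_setVsetC (u @^-1` A) UU.
  have GnA : G (~` A)%classic by apply: UG; rewrite /= /nbhs /=.
  have /filter_ex[x []] : G set0 by rewrite -(setICr A); exact: filterI.
- suff h : U (u @^-1` [set` `[- M, M]]) by exact: h.
  by apply: filterS uM => n; rewrite /= in_itv /= ler_norml.
- by move=> l [_ ul]; exists l.
Qed.

Lemma ultra_le (R : realType) (U : set_system nat) (u v : nat -> R) (a b : R) :
  UltraFilter U -> u n @[n --> U] --> a -> v n @[n --> U] --> b ->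
  U [set n | u n <= v n] -> a <= b.
Proof.
move=> UU ua vb uv; rewrite -subr_ge0 leNgt; apply/negP => ba0.
have uv0 : v n - u n @[n --> U] --> b - a by exact: cvgB.
have [n [n0 nuv]] : exists n, v n - u n < 0 /\ u n <= v n.
  apply: (@filter_ex _ U); apply: filterI uv.
  exact: (cvgr_lt _ uv0).
by move: n0; rewrite subr_lt0 ltNge nuv.
Qed.

(** There are finitely many subfamilies, so a single [L'] is a witness for [U]-many [n]. Thus
    richness is a closed condition on the region. *)
Lemma rich_lim (R : realType) (U : set_system nat) (L : {fset set (plane R)})
    (D : nat -> set (plane R)) (D' : set (plane R)) (p : R) :
  UltraFilter U -> U [set n | rich L (D n) p] ->
  (forall q, U [set n | D n q] -> D' q) -> rich L D' p.
Proof.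
move=> UU rD DD'.
have UP : U [set n | exists2 L', L' \in enum_fset (fpowerset L) &
    (intersection_points L' `<=` D n)%classic /\ p <= #|` L'|%:R].
  apply: filterS rD => n [L' [L'L h1 h2]]; exists L' => //.
  by rewrite -[_ \in _]/(L' \in fpowerset L) fpowersetE.
have [L' L'P UL'] := ultra_ex_seq UU UP.
have L'L : L' `<=` L by rewrite -fpowersetE.
exists L'; split=> //.
  move=> q qL'; apply: DD'; apply: filterS UL' => n [+ _]; exact.
by have /filter_ex[n []] := UL'.
Qed.

(** * Lines as graphs *)

Definition lin (R : realType) (a b : R) (q : plane R) : R :=
  a * q 0 0 + b * q 0 1.

Definition nice (R : realType) (L : {fset set (plane R)}) : Prop :=
  [/\ line_set L,
      forall l m, l \in L -> m \in L -> l != m -> ~ parallel l m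
    & forall l m n, l \in L -> m \in L -> n \in L ->
         l != m -> l != n -> m != n -> (l `&` m `&` n = set0)%classic].

Definition crosses (R : realType) (a b : R) (l : set (plane R)) : Prop :=
  exists p v, l = line_through p v /\ lin a b v != 0.

Lemma niceS (R : realType) (L L' : {fset set (plane R)}) :
  L' `<=` L -> nice L -> nice L'.
Proof.
move=> /fsubsetP sub [h1 h2 h3]; split.
- by move=> l /sub; exact: h1.
- by move=> l m /sub lL /sub; exact: h2.
- by move=> l m n /sub lL /sub mL /sub; exact: h3.
Qed.

Lemma linD (R : realType) (a b : R) (q q' : plane R) :
  lin a b (q + q') = lin a b q + lin a b q'.
Proof. by rewrite /lin !mxE; ring. Qed.

Lemma linZ (R : realType) (a b t : R) (q : plane R) :
  lin a b (t *: q) = t * lin a b q.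
Proof. by rewrite /lin !mxE; ring. Qed.

Lemma linN (R : realType) (a b : R) (q : plane R) :
  lin (- a) (- b) q = - lin a b q.
Proof. by rewrite /lin; ring. Qed.

Lemma frame_inj (R : realType) (a b c d : R) (q q' : plane R) :
  a * d - b * c != 0 -> lin a b q = lin a b q' -> lin c d q = lin c d q' ->
  q = q'.
Proof.
rewrite /lin => det e1 e2.
have e0 : (a * d - b * c) * (q 0 0 - q' 0 0) = 0.
  transitivity (d * (a * q 0 0 + b * q 0 1 - (a * q' 0 0 + b * q' 0 1))
    - b * (c * q 0 0 + d * q 0 1 - (c * q' 0 0 + d * q' 0 1))); first by ring.
  by rewrite e1 e2; ring.
have e0' : (a * d - b * c) * (q 0 1 - q' 0 1) = 0.
  transitivity (a * (c * q 0 0 + d * q 0 1 - (c * q' 0 0 + d * q' 0 1))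
    - c * (a * q 0 0 + b * q 0 1 - (a * q' 0 0 + b * q' 0 1))); first by ring.
  by rewrite e1 e2; ring.
move/eqP: e0; rewrite mulf_eq0 (negbTE det) /= subr_eq0 => /eqP e0.
move/eqP: e0'; rewrite mulf_eq0 (negbTE det) /= subr_eq0 => /eqP e0'.
apply/rowP => -[[|[|//]] i2].
  by have -> : Ordinal i2 = 0 by exact/val_inj.
by have -> : Ordinal i2 = 1 by exact/val_inj.
Qed.

Lemma frame_surj (R : realType) (a b c d x y : R) :
  a * d - b * c != 0 ->
  exists q : plane R, lin a b q = x /\ lin c d q = y.
Proof.
move=> det.
exists (\row_j if j == 0 then (d * x - b * y) / (a * d - b * c)
          else (a * y - c * x) / (a * d - b * c)).
by rewrite /lin !mxE /=; split; field.
Qed.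

Lemma crosses_graph (R : realType) (a b c d : R) (l : set (plane R)) :
  a * d - b * c != 0 -> crosses a b l ->
  exists MK : R * R, forall q, l q <-> lin c d q = MK.1 * lin a b q + MK.2.
Proof.
move=> det [p [v [-> v0]]].
exists (lin c d v / lin a b v, lin c d p - lin c d v / lin a b v * lin a b p).
move=> q /=; split.
  by move=> [t _ <-]; rewrite !linD !linZ; field.
move=> e; exists ((lin a b q - lin a b p) / lin a b v) => //.
apply: (frame_inj det); rewrite linD linZ; first by field.
by rewrite e; field.
Qed.

Lemma graph_parallel (R : realType) (a b c d M K K' : R)
    (l l' : set (plane R)) :
  a * d - b * c != 0 ->
  (forall q, l q <-> lin c d q = M * lin a b q + K) ->
  (forall q, l' q <-> lin c d q = M * lin a b q + K') -> parallel l l'.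
Proof.
move=> det lP l'P.
have [v [v1 v2]] := frame_surj 1 M det.
have [p [p1 p2]] := frame_surj 0 K det.
have [p' [p'1 p'2]] := frame_surj 0 K' det.
have H K0 (l0 : set (plane R)) p0 : (forall q, l0 q <-> lin c d q = M * lin a b q + K0) ->
    lin a b p0 = 0 -> lin c d p0 = K0 -> l0 = line_through p0 v.
  move=> l0P e1 e2; apply/seteqP; split=> q.
    move=> /l0P e; exists (lin a b q) => //.
    by apply: (frame_inj det); rewrite linD linZ ?v1 ?v2 ?e1 ?e2 ?e; ring.
  move=> [t _ <-]; apply/l0P; rewrite !linD !linZ v1 v2 e1 e2; ring.
exists p, p', v; split; [|exact: H|exact: H].
apply/eqP => v0; move: v1; rewrite v0 /lin !mxE !mulr0 addr0 => /eqP.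
by rewrite eq_sym oner_eq0.
Qed.

Lemma nice_graphs (R : realType) (a b c d : R) (L S : {fset set (plane R)}) :
  a * d - b * c != 0 -> nice L -> S `<=` L ->
  {in S, forall l, crosses a b l} ->
  exists M K : set (plane R) -> R,
    (forall l, l \in S -> forall q, l q <-> lin c d q = M l * lin a b q + K l)
    /\ {in S &, injective M}.
Proof.
move=> det [_ npar _] /fsubsetP SL cr.
have /choice[MK MKP] : forall l : set (plane R), exists MK : R * R, l \in S ->
    forall q, l q <-> lin c d q = MK.1 * lin a b q + MK.2.
  move=> l; case: (boolP (l \in S)) => [lS|_]; last by exists 0.
  have [MK MKP] := crosses_graph det (cr l lS); by exists MK.
exists (fun l => (MK l).1), (fun l => (MK l).2); split; first exact: MKP.
move=> l m lS mS e; apply/eqP; apply: contrapT => /negP lm.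
apply: (npar l m (SL _ lS) (SL _ mS) lm).
by apply: (graph_parallel det (MKP l lS)); rewrite e; exact: MKP.
Qed.

(** [x13] is the mean of [x12] and [x23] with the positive weights [m2 - m1] and [m3 - m2]; this is
    [e4]. *)
Lemma between_meets (R : realFieldType) (m1 m2 m3 k1 k2 k3 : R) :
  m1 < m2 -> m2 < m3 ->
  let x12 := (k1 - k2) / (m2 - m1) in
  let x23 := (k2 - k3) / (m3 - m2) in
  let x13 := (k1 - k3) / (m3 - m1) in
  x12 <= x13 <= x23 \/ x23 <= x13 <= x12.
Proof.
move=> m12 m23 x12 x23 x13.
have u : 0 < m2 - m1 by lra.
have w : 0 < m3 - m2 by lra.
have e1 : x12 * (m2 - m1) = k1 - k2 by rewrite /x12 mulfVK // gt_eqF.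
have e2 : x23 * (m3 - m2) = k2 - k3 by rewrite /x23 mulfVK // gt_eqF.
have e3 : x13 * (m3 - m1) = k1 - k3 by rewrite /x13 mulfVK // gt_eqF //; lra.
have e4 : (x13 - x12) * (m2 - m1) = (x23 - x13) * (m3 - m2) by nra.
case: (lerP x12 x13) => h; [left|right]; rewrite ?h ?(ltW h) ?andbT /=.
  have : 0 <= (x23 - x13) * (m3 - m2) by rewrite -e4 mulr_ge0 ?subr_ge0 // ltW.
  by rewrite pmulr_lge0 // subr_ge0.
have : (x23 - x13) * (m3 - m2) <= 0.
  by rewrite -e4 mulr_le0_ge0 ?subr_le0 // ltW.
by rewrite pmulr_lle0 // subr_le0.
Qed.

(* A pair of lines is ordered by slope when it meets inside [D].  This relation
   is transitive as soon as every line leaves [D] at most once in a fixed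
   direction, because the middle one of the three abscissas of a triangle lies
   between the other two. *)
Lemma graph_chain_or_antichain (R : realType) (X Y : plane R -> R)
    (M K : set (plane R) -> R) (S : {fset set (plane R)})
    (D : R -> R -> Prop) (p p' : R) :
  (forall l, l \in S -> forall q, l q <-> Y q = M l * X q + K l) ->
  {in S &, injective M} ->
  (forall l, l \in S -> forall x x', x' <= x ->
     D x (M l * x + K l) -> D x' (M l * x' + K l)) \/
  (exists c, (forall x y, D x y -> x <= c) /\
    forall l, l \in S -> forall x x', x <= x' -> x' <= c ->
     D x (M l * x + K l) -> D x' (M l * x' + K l)) ->
  0 < p -> p * p' <= #|` S|%:R ->
  rich S [set q | D (X q) (Y q)] p \/
  exists E : {fset set (plane R)}, [/\ E `<=` S, p' <= #|` E|%:R
     & forall q, intersection_points E q -> ~ D (X q) (Y q)].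
Proof.
move=> lP Minj mono p0 pp'.
pose x l m := (K l - K m) / (M m - M l).
pose r l m := [&& l \in S, m \in S, M l < M m &
                  `[< D (x l m) (M l * x l m + K l) >]].
have xP l m q : l \in S -> m \in S -> M l < M m -> l q -> m q -> X q = x l m.
  move=> lS mS Mlm /lP -/(_ lS) e /lP -/(_ mS) e'.
  by rewrite /x; apply: (canRL (mulfK _)); [rewrite gt_eqF //|]; lra.
have xE l m : M l < M m -> M l * x l m + K l = M m * x l m + K m.
  by move=> Mlm; rewrite /x; field; lra.
have rt : transitive r.
  move=> m l n /and4P[lS mS lm /asboolP Dlm] /and4P[_ nS mn /asboolP Dmn].
  rewrite /r lS nS (lt_trans lm mn) /=; apply/asboolP.
  have ln := lt_trans lm mn.
  rewrite (xE _ _ mn) in Dmn.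
  have := between_meets (K l) (K m) (K n) lm mn; rewrite /= -!/(x _ _).
  case: mono => [down|[c [Dc up]]].
    by move=> [/andP[h1 h2]|/andP[h1 h2]]; [rewrite xE //; exact: down h2 Dmn|exact: down h2 Dlm].
  (* The third abscissa is at most one of the other two, hence at most [c], and [up] reaches it from
     the smaller one. *)
  have c1 := Dc _ _ Dlm; have c2 := Dc _ _ Dmn.
  move=> [/andP[h1 h2]|/andP[h1 h2]].
    exact: (up _ lS _ _ h1 (le_trans h2 c2) Dlm).
  rewrite xE //; exact: (up _ nS _ _ h1 (le_trans h2 c1) Dmn).
have ri : irreflexive r by move=> l; rewrite /r ltxx andbF /= !andbF.
have rD : {in S &, forall l m, r l m -> forall q, l q -> m q ->
    [set q | D (X q) (Y q)] q}.
  move=> l m lS mS /and4P[_ _ lm /asboolP Dlm] q lq mq /=.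
  by rewrite (proj1 (lP l lS q) lq) (xP l m).
have [|[E [ES pE antiE]]] := chain_or_antichain_rich rt ri rD p0 pp'; first by left.
right; exists E; split=> // q [l [m [lE mE lm lq mq]]] Dq.
have lS := fsubsetP ES l lE; have mS := fsubsetP ES m mE.
wlog Mlm : l m lE mE lm lq mq lS mS / M l < M m.
  move=> wl; case: (ltrgtP (M l) (M m)) => h.
  - exact: (wl l m).
  - by apply: (wl m l) => //; rewrite eq_sym.
  - by move/eqP: lm; apply; exact: Minj.
have := antiE l m lE mE; rewrite /r lS mS Mlm /= => /negP; apply.
apply/asboolP; move: Dq; rewrite (proj1 (lP l lS q) lq) (xP l m) //.
Qed.

(** * Halfplanes and fans *)

Definition halfplane (R : realType) (a b c : R) : set (plane R) :=
  [set q | lin a b q <= c].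

Lemma line_through_scale (R : realType) (k : R) (p v : plane R) :
  k != 0 -> line_through p (k *: v) = line_through p v.
Proof.
move=> k0; apply/seteqP; split=> q [t _ <-].
  by exists (t * k) => //; rewrite scalerA.
by exists (t / k) => //; rewrite scalerA divfK.
Qed.

(** All lines of [A] but at most one are graphs over [lin a b]; the exception is parallel to the
    boundary and accounts for the [- 1]. *)
Lemma halfplane_cover (R : realType) (A : {fset set (plane R)})
    (a b c p p' : R) :
  nice A -> a != 0 \/ b != 0 -> 0 < p -> p * p' <= #|` A|%:R - 1 ->
  rich A (halfplane a b c) p \/ rich A (halfplane (- a) (- b) (- c)) p'.
Proof.
move=> nA ab p0 pp'.
have det : a * a - b * (- b) != 0.
  rewrite mulrN opprK -!expr2 paddr_eq0 ?sqr_ge0 // !sqrf_eq0.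
  by case: ab => /negbTE->; rewrite ?andbF.
pose S := [fset l in A | `[< crosses a b l >]].
have SA : S `<=` A by apply: fset_sub.
have cardS : (#|` A| <= #|` S| + 1)%N.
  have := cardfsID S A; rewrite (fsetIidPr SA) => <-.
  rewrite leq_add2l; have [->|[l lAS]] := fset_0Vmem (A `\` S).
    by rewrite cardfs0.
  suff /fsubset_leq_card : A `\` S `<=` [fset l] by rewrite cardfs1.
  apply/fsubsetP => m mAS; rewrite inE eq_sym; apply: contrapT => /negP lm.
  have [_ npar _] := nA.
  have [u [u1 u2]] := frame_surj 0 1 det.
  have H n : n \in A `\` S -> n \in A /\ exists p, n = line_through p u.
    rewrite !inE /= negb_and => /andP[/orP[/negbTE->//|ncr] nA'].
    split=> //; have [hA _ _] := nA; have [q [v [v0 nE]]] := hA n nA'.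
    exists q; have [w0|w0] := eqVneq (lin a b v) 0; last first.
      by case/negP: ncr; apply/asboolP; exists q, v.
    have vE : v = lin (- b) a v *: u.
      by apply: (frame_inj det); rewrite linZ ?u1 ?u2 ?mulr1 ?mulr0.
    rewrite nE vE line_through_scale //; apply: contra v0 => /eqP e.
    by rewrite vE e scale0r.
  have [lA [q lq]] := H l lAS; have [mA [q' mq]] := H m mAS.
  apply: (npar l m lA mA lm); exists q, q', u; split=> //.
  apply/eqP => u0; move: u2; rewrite u0 /lin !mxE !mulr0 addr0 => /eqP.
  by rewrite eq_sym oner_eq0.
have [|M [K [lP Minj]]] := nice_graphs det nA SA.
  by move=> l; rewrite !inE /= => /andP[_ /asboolP].
have down : forall l, l \in S -> forall x x', x' <= x -> x <= c -> x' <= c.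
  by move=> l _ x x' h; exact: le_trans.
have pS : p * p' <= #|` S|%:R.
  by rewrite (le_trans pp') // lerBlDr -[1]/(1%:R) -natrD ler_nat.
have [|[E [ES pE IE]]] := graph_chain_or_antichain (D := fun x y => x <= c)
  lP Minj (or_introl down) p0 pS.
  move=> [L' [L'S h1 h2]]; left; exists L'; split=> //.
  exact: fsubset_trans SA.
right; exists E; split=> //; first exact: fsubset_trans SA.
move=> q /IE /negP; rewrite -ltNge => /ltW h.
by rewrite /halfplane /= linN lerN2.
Qed.

(* Coordinates are [x = lin a b] and [y = lin 0 1].  The fan has its apex at
   [(x0, h / (1 - |h|))], a ray pointing down, and a left ray turning from down
   ([s = -1]) through horizontal ([s = 0]) to up ([s = 1]); likewise the right
   ray with [t].  [h = -1] and [h = 1] put the apex at infinity.  [wedge a b] is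
   the part left of the vertical ray; the right one is
   [wedge (- a) (- b) (- x0) h t], its mirror image.  The part [top] is bounded
   by the two other rays, and the fan is convex when [0 <= s + t]. *)
Definition phi (R : realType) (x0 h s x y : R) : R :=
  s * (x - x0) + (1 - `|s|) * ((1 - `|h|) * y - h).

Definition wedge (R : realType) (a b x0 h s : R) : set (plane R) :=
  [set q | lin a b q <= x0 /\ phi x0 h s (lin a b q) (lin 0 1 q) <= 0].

Definition top (R : realType) (a b x0 h s t : R) : set (plane R) :=
  [set q | 0 <= phi x0 h s (lin a b q) (lin 0 1 q) /\
           0 <= phi (- x0) h t (lin (- a) (- b) q) (lin 0 1 q)].

Lemma fan_cover_plane (R : realType) (a b x0 h s t : R) (q : plane R) :
  -1 <= s <= 1 -> -1 <= t <= 1 -> 0 <= s + t ->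
  [\/ wedge a b x0 h s q, wedge (- a) (- b) (- x0) h t q
    | top a b x0 h s t q].
Proof.
move=> /andP[s1 s2] /andP[t1 t2] st.
rewrite /wedge /top /phi /= linN.
set u := lin a b q - x0; set g := (1 - `|h|) * lin 0 1 q - h.
have -> : - lin a b q - - x0 = - u by rewrite /u; ring.
have -> : (lin a b q <= x0) = (u <= 0) by rewrite subr_le0.
have -> : (- lin a b q <= - x0) = (0 <= u) by rewrite lerN2 subr_ge0.
(* A point on the left and above the left ray is also above the line of the right ray, since
   [0 <= s' + t'] makes the angle of the top at most straight. By symmetry this serves both
   sides. *)
have key (s' t' u' : R) : -1 <= s' -> s' <= 1 -> -1 <= t' -> t' <= 1 ->
    0 <= s' + t' -> u' <= 0 -> 0 < s' * u' + (1 - `|s'|) * g ->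
    0 <= t' * (- u') + (1 - `|t'|) * g.
  move=> {}s1 {}s2 {}t1 {}t2 {}st u0.
  have t1' : 0 <= 1 - `|t'| by rewrite subr_ge0 ler_norml t1.
  have s1' : 0 <= 1 - `|s'| by rewrite subr_ge0 ler_norml s1.
  have u0' : 0 <= - u' by rewrite oppr_ge0.
  case: (lerP 0 t') => ht; last first.
    rewrite (ltr0_norm ht) (@ger0_norm _ s'); last lra.
    move=> h0; have g0 : 0 <= g.
      have : 0 < (1 - s') * g.
        by have := mulr_ge0 (_ : 0 <= s') u0'; lra.
      move=> h1; rewrite leNgt; apply/negP => g0.
      by have := @mulr_ge0 _ (1 - s') (- g); lra.
    by have := mulr_ge0 st (addr_ge0 g0 u0'); lra.
  case: (lerP 0 g) => hg.
    by move=> _; rewrite addr_ge0 // mulr_ge0.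
  case: (lerP 0 s') => hs.
    have := mulr_ge0 hs u0'; have := mulr_ge0 s1' (_ : 0 <= - g); lra.
  rewrite (ltr0_norm hs) (ger0_norm ht) => h0.
  have gu : 0 <= - u' - g by lra.
  by have := mulr_ge0 st gu; lra.
case: (lerP u 0) => u0.
  case: (lerP (s * u + (1 - `|s|) * g) 0) => hs.
    by constructor 1.
  by constructor 3; split; [exact: ltW|exact: (key s t u)].
case: (lerP (t * (- u) + (1 - `|t|) * g) 0) => ht.
  by constructor 2; split=> //; exact: ltW.
constructor 3; split; last exact: ltW.
by rewrite -[u]opprK; apply: (key t s (- u)) => //; [rewrite addrC|rewrite oppr_le0 ltW].
Qed.

Lemma crossesN (R : realType) (a b : R) (l : set (plane R)) :
  crosses a b l -> crosses (- a) (- b) l.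
Proof. by move=> [p [v [-> v0]]]; exists p, v; rewrite linN oppr_eq0. Qed.

(** Along a line [phi] is affine in the abscissa, and for [s < 1] its sign at [x0] tells on which
    side of the apex the line passes. If all lines pass below, a line in the wedge stays there up to
    [x0]; if all pass above, it stays there to the left. These are the two cases of
    [graph_chain_or_antichain]. *)
Lemma wedge_chain_or_antichain (R : realType) (A S : {fset set (plane R)})
    (a b x0 h s p p' : R) :
  nice A -> S `<=` A -> a != 0 -> {in S, forall l, crosses a b l} ->
  `|h| < 1 -> -1 < s <= 1 ->
  {in S, forall l q, l q -> lin a b q = x0 ->
     (1 - `|h|) * lin 0 1 q - h <= 0} \/
  {in S, forall l q, l q -> lin a b q = x0 ->
     0 < (1 - `|h|) * lin 0 1 q - h} ->
  0 < p -> p * p' <= #|` S|%:R ->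
  rich S (wedge a b x0 h s) p \/
  exists E : {fset set (plane R)}, [/\ E `<=` S, p' <= #|` E|%:R
     & forall q, intersection_points E q -> ~ wedge a b x0 h s q].
Proof.
move=> nA SA a0 cr h1 /andP[s1 s2] side p0 pp'.
have det : a * 1 - b * 0 != 0 by rewrite mulr0 mulr1 subr0.
have [M [K [lP Minj]]] := nice_graphs det nA SA cr.
have apex l : l \in S -> exists q, [/\ l q, lin a b q = x0 & lin 0 1 q = M l * x0 + K l].
  move=> lS; have [q [q1 q2]] := frame_surj x0 (M l * x0 + K l) det.
  by exists q; split=> //; apply/(lP l lS); rewrite q2 q1.
apply: (graph_chain_or_antichain (D := fun x y => x <= x0 /\ phi x0 h s x y <= 0)
  lP Minj _ p0 pp').
case: side => side; [right; exists x0; split; first by move=> x y []|left].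
  move=> l lS x x' xx' x'0 [xx0]; rewrite /phi => px; split=> //.
  have [q [lq q1 q2]] := apex l lS.
  have := side l lS q lq q1; rewrite q2.
  move=> g0.
  pose F z := s * (z - x0) + (1 - `|s|) * ((1 - `|h|) * (M l * z + K l) - h).
  have Fx0 : F x0 <= 0.
    rewrite /F subrr mulr0 add0r mulr_ge0_le0 // subr_ge0 ler_norml; lra.
  rewrite -/(F x) in px; rewrite -/(F x').
  have [e|ne] := eqVneq x x0.
    by have -> : x' = x0 by apply/eqP; rewrite eq_le x'0 -e xx'.
  have xx0' : 0 < x0 - x by rewrite subr_gt0 lt_neqAle ne.
  rewrite -(pmulr_rle0 _ xx0').
  have -> : (x0 - x) * F x' = (x0 - x') * F x + (x' - x) * F x0.
    by rewrite /F; ring.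
  by rewrite -[leRHS]addr0 lerD // mulr_ge0_le0 // subr_ge0.
move=> l lS x x' x'x [xx0]; rewrite /phi => px; split; first exact: le_trans xx0.
have [q [lq q1 q2]] := apex l lS.
have := side l lS q lq q1; rewrite q2 => g0.
pose F z := s * (z - x0) + (1 - `|s|) * ((1 - `|h|) * (M l * z + K l) - h).
rewrite -/(F x) in px; rewrite -/(F x').
have [s1'|s1'] := eqVneq s 1.
  move: px; rewrite /F s1' normr1 subrr !mul0r !addr0 !mul1r; lra.
have ns : 0 < 1 - `|s|.
  by rewrite subr_gt0 ltr_norml s1 lt_neqAle s1' s2.
have Fx0 : 0 < F x0 by rewrite /F subrr mulr0 add0r mulr_gt0.
have xx0' : 0 < x0 - x.
  rewrite subr_gt0 lt_neqAle xx0 andbT; apply/eqP => e.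
  by move: px; rewrite e leNgt Fx0.
rewrite -(pmulr_rle0 _ xx0').
have -> : (x0 - x) * F x' = (x0 - x') * F x + (x' - x) * F x0.
  by rewrite /F; ring.
rewrite -[leRHS]addr0 lerD //.
  by rewrite mulr_ge0_le0 // subr_ge0 (le_trans x'x).
by rewrite mulr_le0_ge0 ?subr_le0 // ltW.
Qed.

(* At least half of the lines cross the vertical line through the apex on the
   same side of it.  Among those, crossing inside a given lower wedge is a
   transitive relation. *)
Lemma fan_cover (R : realType) (A : {fset set (plane R)})
    (a b x0 h s t p1 p2 p3 : R) :
  nice A -> a != 0 -> {in A, forall l, crosses a b l} ->
  `|h| < 1 -> -1 < s <= 1 -> -1 < t <= 1 -> 0 <= s + t ->
  0 < p1 -> 0 < p2 -> p1 * p2 * p3 <= #|` A|%:R / 2 ->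
  [\/ rich A (wedge a b x0 h s) p1, rich A (wedge (- a) (- b) (- x0) h t) p2
    | rich A (top a b x0 h s t) p3].
Proof.
move=> nA a0 cr h1 s1 t1 st p10 p20 ppp.
pose below l := forall q, l q -> lin a b q = x0 -> (1 - `|h|) * lin 0 1 q - h <= 0.
pose S1 := [fset l in A | `[< below l >]].
have S1A : S1 `<=` A by apply: fset_sub.
have half (S : {fset set (plane R)}) : S `<=` A -> #|` A|%:R / 2 <= #|` S|%:R :> R ->
    {in S, forall l q, l q -> lin a b q = x0 ->
      (1 - `|h|) * lin 0 1 q - h <= 0} \/
    {in S, forall l q, l q -> lin a b q = x0 ->
      0 < (1 - `|h|) * lin 0 1 q - h} ->
    [\/ rich A (wedge a b x0 h s) p1, rich A (wedge (- a) (- b) (- x0) h t) p2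
      | rich A (top a b x0 h s t) p3].
  move=> SA cardS side.
  have up (S0 : {fset set (plane R)}) C p : S0 `<=` A -> rich S0 C p -> rich A C p.
    by move=> S0A [L' [h2 h3 h4]]; exists L'; split=> //; exact: fsubset_trans S0A.
  have pS : p1 * (p2 * p3) <= #|` S|%:R by rewrite mulrA (le_trans ppp).
  have crS : {in S, forall l, crosses a b l} by move=> l /(fsubsetP SA); exact: cr.
  have [|[E [ES pE IE]]] := wedge_chain_or_antichain nA SA a0 crS h1 s1 side p10 pS.
    by move/(up _ _ _ SA); constructor 1.
  have EA := fsubset_trans ES SA.
  have a0' : - a != 0 by rewrite oppr_eq0.
  have crE : {in E, forall l, crosses (- a) (- b) l}.
    by move=> l /(fsubsetP EA) lA; apply/crossesN/cr.
  have sideE : {in E, forall l q, l q -> lin (- a) (- b) q = - x0 ->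
      (1 - `|h|) * lin 0 1 q - h <= 0} \/
    {in E, forall l q, l q -> lin (- a) (- b) q = - x0 ->
      0 < (1 - `|h|) * lin 0 1 q - h}.
    by case: side => side; [left|right] => l lE q lq; rewrite linN => /oppr_inj;
      apply: (side l _ q lq); exact: (fsubsetP ES).
  have [|[E' [E'E pE' IE']]] :=
    wedge_chain_or_antichain nA EA a0' crE h1 t1 sideE p20 pE.
    by move/(up _ _ _ EA); constructor 2.
  constructor 3; exists E'; split=> //; first exact: fsubset_trans E'E EA.
  move=> q qE'.
  have [] := @fan_cover_plane _ a b x0 h s t q _ _ st.
  - by case/andP: s1 => /ltW-> ->.
  - by case/andP: t1 => /ltW-> ->.
  - move=> /IE []; case: qE' => l [m [lE' mE' lm lq mq]].
    by exists l, m; split=> //; exact: (fsubsetP E'E).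
  - by move=> /IE' [].
  - by [].
have cardA : #|` A|%:R = #|` S1|%:R + #|` A `\` S1|%:R :> R.
  by rewrite -natrD -(cardfsID S1 A) (fsetIidPr S1A).
case: (lerP (#|` A|%:R / 2) (#|` S1|%:R : R)) => hS1.
  apply: (half S1 S1A hS1); left => l; rewrite !inE /= => /andP[_ /asboolP].
  exact.
apply: (half (A `\` S1)); first exact: fsubsetDl.
  lra.
right => l; rewrite !inE /= negb_and => /andP[/orP[/negbTE->//|nb] lA] q lq q1.
rewrite ltNge; apply: contra nb => g0; apply/asboolP => q' lq' q'1.
have det : a * 1 - b * 0 != 0 by rewrite mulr0 mulr1 subr0.
have [MK lP] := crosses_graph det (cr l lA).
move: g0; rewrite (proj1 (lP q) lq) (proj1 (lP q') lq') q1 q'1; exact.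
Qed.

(** * Extremal halfplanes *)

Definition normal (R : realType) (v : plane R) : plane R -> R :=
  lin (- v 0 1) (v 0 0).

Lemma direction_frame (R : realType) (v : plane R) :
  v != 0 -> (- v 0 1) * v 0 1 - v 0 0 * v 0 0 != 0.
Proof.
move=> v0; have e : v 0 0 ^+ 2 + v 0 1 ^+ 2 != 0.
  rewrite paddr_eq0 ?sqr_ge0 // !sqrf_eq0; apply: contra v0.
  move=> /andP[/eqP e1 /eqP e2]; apply/eqP/rowP => -[[|[|//]] i2]; rewrite mxE.
    by rewrite -e1; congr (v _ _); exact/val_inj.
  by rewrite -e2; congr (v _ _); exact/val_inj.
apply: contra e => /eqP e; apply/eqP; rewrite !expr2; lra.
Qed.

Lemma normal0_colinear (R : realType) (v w : plane R) :
  v != 0 -> normal v w = 0 -> exists k, w = k *: v.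
Proof.
move=> v0 w0; have det := direction_frame v0.
have e : lin (v 0 0) (v 0 1) v != 0.
  by rewrite /lin; apply: contra det => /eqP e; apply/eqP; lra.
exists (lin (v 0 0) (v 0 1) w / lin (v 0 0) (v 0 1) v).
apply: (frame_inj det); rewrite linZ; last by rewrite divfK.
by rewrite -/(normal v) w0 /normal /lin; ring.
Qed.

Lemma mem_line_through (R : realType) (p v q : plane R) :
  v != 0 -> line_through p v q <-> normal v q = normal v p.
Proof.
move=> v0; split.
  by move=> [t _ <-]; rewrite /normal /lin !mxE; ring.
move=> e; have [|k kE] := @normal0_colinear _ v (q - p) v0.
  by move: e; rewrite /normal /lin !mxE; lra.
by exists k => //; rewrite -kE addrC subrK.
Qed.

Lemma nice_transversal (R : realType) (L : {fset set (plane R)})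
    (l m : set (plane R)) :
  nice L -> l \in L -> m \in L -> l != m ->
  exists p v q w, [/\ v != 0, l = line_through p v, m = line_through q w
    & normal v w != 0].
Proof.
move=> [hL npar _] lL mL lm.
have [p [v [v0 lE]]] := hL l lL; have [q [w [w0 mE]]] := hL m mL.
exists p, v, q, w; split=> //; apply/eqP => e.
apply: (npar l m lL mL lm); exists p, q, v; split=> //.
have [k kE] := normal0_colinear v0 e.
rewrite mE kE line_through_scale //.
by apply: contra w0; rewrite kE => /eqP->; rewrite scale0r.
Qed.

Lemma nice_meet (R : realType) (L : {fset set (plane R)})
    (l m : set (plane R)) :
  nice L -> l \in L -> m \in L -> l != m -> exists q, l q /\ m q.
Proof.
move=> nL lL mL lm.
have [p [v [q [w [v0 -> -> vw]]]]] := nice_transversal nL lL mL lm.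
exists (q + ((normal v p - normal v q) / normal v w) *: w); split.
  by apply/mem_line_through => //; rewrite {1}/normal linD linZ -!/(normal v _) divfK // addrC subrK.
by exists ((normal v p - normal v q) / normal v w).
Qed.

Lemma nice_meet_unique (R : realType) (L : {fset set (plane R)})
    (l m : set (plane R)) (x y : plane R) :
  nice L -> l \in L -> m \in L -> l != m -> l x -> m x -> l y -> m y -> x = y.
Proof.
move=> nL lL mL lm.
have [p [v [q [w [v0 -> -> vw]]]]] := nice_transversal nL lL mL lm.
move=> /(mem_line_through _ _ v0) ex [t _ tx] /(mem_line_through _ _ v0) ey [u _ uy].
have e : u * normal v w = t * normal v w.
  by move: ex ey; rewrite -tx -uy /normal !linD !linZ; lra.
by rewrite -tx -uy (mulIf vw e).
Qed.

Lemma intersections_bounded (R : realType) (L : {fset set (plane R)}) :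
  nice L -> exists M : R, 0 <= M /\ forall q, intersection_points L q ->
    `|q 0 0| <= M /\ `|q 0 1| <= M.
Proof.
move=> nL.
have /choice[g gP] : forall lm : set (plane R) * set (plane R), exists M : R,
    0 <= M /\ (lm.1 \in L -> lm.2 \in L -> lm.1 != lm.2 ->
      forall q, lm.1 q -> lm.2 q -> `|q 0 0| + `|q 0 1| <= M).
  move=> [l m] /=.
  case: (pselect [/\ l \in L, m \in L & l != m]) => [[lL mL lm]|nlm]; last first.
    by exists 0; split=> // lL mL lm; case: nlm.
  have [x [lx mx]] := nice_meet nL lL mL lm.
  exists (`|x 0 0| + `|x 0 1|); split; first exact: addr_ge0.
  by move=> _ _ _ q lq mq; rewrite (nice_meet_unique nL lL mL lm lq mq lx mx).
exists (\sum_(l <- L) \sum_(m <- L) g (l, m)).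
have g0 l : 0 <= \sum_(m <- L) g (l, m).
  by apply: sumr_ge0 => m _; have [] := gP (l, m).
split; first by apply: sumr_ge0.
move=> q [l [m [lL mL lm lq mq]]].
have [_ /(_ lL mL lm q lq mq) h] := gP (l, m).
have h2 : `|q 0 0| + `|q 0 1| <= \sum_(l <- L) \sum_(m <- L) g (l, m).
  rewrite (le_trans h) // (big_rem l) //= ler_wpDr ?sumr_ge0 //.
  rewrite (big_rem m) //= ler_wpDr // sumr_ge0 // => m' _.
  by have [] := gP (l, m').
by split; rewrite (le_trans _ h2) // ?lerDl ?lerDr.
Qed.

(** Thresholds above 1 give a crossing inside the region, which confines the position of a halfplane
    to a bounded range. *)
Lemma rich_point (R : realType) (L : {fset set (plane R)}) (C : set (plane R))
    (p : R) :
  nice L -> 1 < p -> rich L C p -> exists2 q, intersection_points L q & C q.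
Proof.
move=> nL p1 [L' [/fsubsetP L'L IC pL']].
have : (1 < #|` L'|)%N by rewrite -(ltr_nat R) (lt_le_trans p1).
have [->|[l lL']] := fset_0Vmem L'; first by rewrite cardfs0.
rewrite (cardfsD1 l) lL' ltnS cardfs_gt0 => /fset0Pn[m].
rewrite in_fsetD1 => /andP[ml mL'].
have lm : l != m by rewrite eq_sym.
have [q [lq mq]] := nice_meet nL (L'L _ lL') (L'L _ mL') lm.
exists q; first by exists l, m; split=> //; exact: L'L.
by apply: IC; exists l, m.
Qed.

Lemma ultra_harmonic (R : realType) (U : set_system nat) :
  (\oo `<=` U)%classic -> (n.+1%:R^-1 : R) @[n --> U] --> (0 : R).
Proof.
move=> oU; apply: cvg_trans (@cvg_harmonic R).
by move=> A; exact: oU.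
Qed.

Lemma cvg_lin (R : realType) (U : set_system nat) (a b : nat -> R) (a' b' : R)
    (q : plane R) :
  Filter U -> a n @[n --> U] --> a' -> b n @[n --> U] --> b' ->
  lin (a n) (b n) q @[n --> U] --> lin a' b' q.
Proof.
by move=> FU ha hb; apply: cvgD; apply: cvgM => //; exact: cvg_cst.
Qed.

Lemma halfplane_lim (R : realType) (U : set_system nat)
    (L : {fset set (plane R)}) (a b c : nat -> R) (a' b' c' p : R) :
  UltraFilter U -> a n @[n --> U] --> a' -> b n @[n --> U] --> b' ->
  c n @[n --> U] --> c' -> U [set n | rich L (halfplane (a n) (b n) (c n)) p] ->
  rich L (halfplane a' b' c') p.
Proof.
move=> UU ha hb hc rU; apply: (rich_lim UU rU) => q Uq.
rewrite /halfplane /=.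
have hl : lin (a n) (b n) q @[n --> U] --> lin a' b' q by exact: cvg_lin.
exact: (ultra_le UU hl hc Uq).
Qed.

Lemma lin_bounded (R : realType) (a b M : R) (q : plane R) :
  `|q 0 0| <= M /\ `|q 0 1| <= M -> `|lin a b q| <= (`|a| + `|b|) * M.
Proof.
move=> [q0 q1]; rewrite /lin (le_trans (ler_normD _ _)) // mulrDl !normrM.
by rewrite lerD // ler_wpM2l.
Qed.

(** [c] is the infimum of the rich positions, attained because richness is closed. At smaller
    positions the covering lemma makes the opposite halfplane rich, and this too survives the
    limit. *)
Lemma least_halfplane (R : realType) (L : {fset set (plane R)})
    (a b p p' : R) :
  nice L -> a != 0 \/ b != 0 -> 1 < p -> 1 < p' -> p * p' <= #|` L|%:R - 1 ->
  exists c, [/\ rich L (halfplane a b c) p,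
     rich L (halfplane (- a) (- b) (- c)) p'
   & forall d, rich L (halfplane a b d) p -> c <= d].
Proof.
move=> nL ab p1 p'1 pp'.
have p0 : 0 < p by rewrite (lt_trans ltr01).
have [U [UU oU]] := ultra_exists.
have [M [M0 MP]] := intersections_bounded nL.
pose T := [set c | rich L (halfplane a b c) p].
have Tup c d : c <= d -> T c -> T d.
  by move=> cd; apply: richS => // q _; rewrite /halfplane /= => /le_trans; apply.
have lb : lbound T (- ((`|a| + `|b|) * M)).
  move=> c /(rich_point nL p1)[q Iq qc].
  by rewrite (le_trans _ qc) // (lerNnormlW (lin_bounded _ _ (MP q Iq))).
have T0 : T !=set0.
  exists ((`|a| + `|b|) * M + 1).
  have [//|] := halfplane_cover ((`|a| + `|b|) * M + 1) nL ab p0 pp'.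
  move=> /(rich_point nL p'1)[q Iq].
  rewrite /halfplane /= linN lerN2.
  have := ler_normlW (lin_bounded a b (MP q Iq)); lra.
have Tinf : has_inf T by split=> //; exists (- ((`|a| + `|b|) * M)).
have hcst (x : R) : x @[_ --> U] --> x by exact: cvg_cst.
exists (inf T); split.
- apply: (@halfplane_lim _ U _ (fun=> a) (fun=> b) (fun n => inf T + n.+1%:R^-1)) => //.
    by rewrite -[X in _ --> X]addr0; apply: cvgD => //; exact: ultra_harmonic.
  apply: filterE => n.
  have [|c Tc ci] := @inf_adherent _ T n.+1%:R^-1 _ Tinf; first by rewrite invr_gt0.
  by apply: Tup Tc; exact: ltW.
- apply: (@halfplane_lim _ U _ (fun=> - a) (fun=> - b) (fun n => - (inf T - n.+1%:R^-1))) => //.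
    rewrite -[X in _ --> - X]subr0; apply: cvgN; apply: cvgB => //.
    exact: ultra_harmonic.
  apply: filterE => n.
  have [Tn|//] := halfplane_cover (inf T - n.+1%:R^-1) nL ab p0 pp'.
  have := ge_inf (proj2 Tinf) Tn; rewrite lerBrDr gerDl leNgt.
  by rewrite invr_gt0 ltr0n.
- by move=> d Td; exact: (ge_inf (proj2 Tinf) Td).
Qed.

(** * Balanced halfplanes *)

(** In a sweep by parallel lines, [A] is already rich behind the line while [B] is still rich ahead
    of it. *)
Definition separated (R : realType) (A B : {fset set (plane R)})
    (p p' a b : R) : Prop :=
  exists c, rich A (halfplane a b c) p /\ rich B (halfplane (- a) (- b) (- c)) p'.

(** The position [c n] lies between the values of [lin] at a crossing of [A] and at one of [B],
    hence is bounded and has a limit. *)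
Lemma separated_lim (R : realType) (U : set_system nat)
    (A B : {fset set (plane R)}) (p p' : R) (a b : nat -> R) (a' b' : R) :
  UltraFilter U -> nice A -> nice B -> 1 < p -> 1 < p' ->
  a n @[n --> U] --> a' -> b n @[n --> U] --> b' ->
  (forall n, separated A B p p' (a n) (b n)) -> separated A B p p' a' b'.
Proof.
move=> UU nA nB p1 p'1 ha hb /choice[c cP].
have [M [M0 MP]] := intersections_bounded nA.
have [M' [M'0 M'P]] := intersections_bounded nB.
have [c' hc] : exists c' : R, c n @[n --> U] --> c'.
  apply: (@ultra_cvg _ _ _ ((`|a'| + `|b'| + 2) * (M + M'))) => //.
  have ha1 : U [set n | `|a n| < `|a'| + 1].
    by apply: (cvgr_lt _ (cvg_norm ha)); rewrite ltrDl.
  have hb1 : U [set n | `|b n| < `|b'| + 1].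
    by apply: (cvgr_lt _ (cvg_norm hb)); rewrite ltrDl.
  apply: filterS2 ha1 hb1 => n /= an bn.
  have [/(rich_point nA p1)[q Iq] + /(rich_point nB p'1)[q' Iq']] := cP n.
  rewrite /halfplane /= linN lerN2 => qc q'c.
  have lq := lerNnormlW (lin_bounded (a n) (b n) (MP q Iq)).
  have lq' := ler_normlW (lin_bounded (a n) (b n) (M'P q' Iq')).
  have ab : 0 <= `|a n| + `|b n| by rewrite addr_ge0.
  have abM : (`|a n| + `|b n|) * (M + M') <= (`|a'| + `|b'| + 2) * (M + M').
    by rewrite ler_wpM2r ?addr_ge0 //; lra.
  have h1 := mulr_ge0 ab M0; have h2 := mulr_ge0 ab M'0.
  rewrite ler_norml; apply/andP; split; lra.
exists c'; split; apply: (halfplane_lim UU); try exact: filterE (fun n => proj1 (cP n));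
  try exact: filterE (fun n => proj2 (cP n)); try exact: cvgN; by [].
Qed.

(** Cut at the later of the two least positions. The family that became rich earlier is still rich
    ahead, because the relevant separation happens at this position or beyond. *)
Lemma balanced_of_separated (R : realType) (A B : {fset set (plane R)})
    (a b p p' r r' : R) :
  nice A -> nice B -> a != 0 \/ b != 0 ->
  1 < p -> 1 < p' -> 1 < r -> 1 < r' ->
  p * p' <= #|` A|%:R - 1 -> r * r' <= #|` B|%:R - 1 ->
  separated B A r p' a b -> separated A B p r' a b ->
  exists c, [/\ rich A (halfplane a b c) p, rich A (halfplane (- a) (- b) (- c)) p',
   rich B (halfplane a b c) r & rich B (halfplane (- a) (- b) (- c)) r'].
Proof.
move=> nA nB ab p1 p'1 r1 r'1 pp' rr' [cE [BE AE]] [cF [AF BF]].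
have [x [x1 x2 x3]] := least_halfplane nA ab p1 p'1 pp'.
have [y [y1 y2 y3]] := least_halfplane nB ab r1 r'1 rr'.
have up (L : {fset set (plane R)}) c d z : c <= d -> rich L (halfplane a b c) z ->
    rich L (halfplane a b d) z.
  by move=> cd; apply: richS => // q _; rewrite /halfplane /= => /le_trans; apply.
have down (L : {fset set (plane R)}) c d z : d <= c ->
    rich L (halfplane (- a) (- b) (- c)) z -> rich L (halfplane (- a) (- b) (- d)) z.
  move=> cd; apply: richS => // q _; rewrite /halfplane /= => /le_trans; apply.
  by rewrite lerN2.
case: (lerP y x) => yx.
  exists x; split=> //; first exact: up y1.
  exact: down (x3 _ AF) BF.
exists y; split=> //; first exact: up (ltW yx) x1.
exact: down (y3 _ BE) AE.
Qed.

(* Ham sandwich by continuity: if no balanced halfplane existed, then in every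
   direction exactly one of the two separations would hold, and both conditions
   are closed, so the same one would hold in all directions. *)
Lemma balanced_halfplane (R : realType) (A B : {fset set (plane R)})
    (p p' r r' a0 b0 a1 b1 : R) :
  nice A -> nice B -> 1 < p -> 1 < p' -> 1 < r -> 1 < r' ->
  p * p' <= #|` A|%:R - 1 -> r * r' <= #|` B|%:R - 1 ->
  a0 != 0 \/ b0 != 0 -> a1 != 0 \/ b1 != 0 ->
  separated B A r p' a0 b0 -> separated A B p r' a1 b1 ->
  exists a b c, [/\ a != 0 \/ b != 0,
   rich A (halfplane a b c) p, rich A (halfplane (- a) (- b) (- c)) p',
   rich B (halfplane a b c) r & rich B (halfplane (- a) (- b) (- c)) r'].
Proof.
move=> nA nB p1 p'1 r1 r'1 pp' rr' n0 n1 E0 F1.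
pose E := separated B A r p'; pose F := separated A B p r'.
have good a b : a != 0 \/ b != 0 -> E a b -> F a b -> exists a b c, [/\ a != 0 \/ b != 0,
     rich A (halfplane a b c) p, rich A (halfplane (- a) (- b) (- c)) p',
     rich B (halfplane a b c) r & rich B (halfplane (- a) (- b) (- c)) r'].
  move=> ab hE hF.
  have [c cP] := balanced_of_separated nA nB ab p1 p'1 r1 r'1 pp' rr' hE hF.
  by exists a, b, c; case: cP.
have EF a b : a != 0 \/ b != 0 -> E a b \/ F a b.
  move=> ab; have [c [c1 c2 _]] := least_halfplane nA ab p1 p'1 pp'.
  have r0 : 0 < r by rewrite (lt_trans ltr01).
  by have [h|h] := halfplane_cover c nB ab r0 rr'; [left|right]; exists c.
have path a b a' b' : a * b' - b * a' != 0 -> E a b -> F a' b' ->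
    exists a b c, [/\ a != 0 \/ b != 0,
     rich A (halfplane a b c) p, rich A (halfplane (- a) (- b) (- c)) p',
     rich B (halfplane a b c) r & rich B (halfplane (- a) (- b) (- c)) r'].
  move=> det Eab Fab.
  pose x (t : R) := a + t * (a' - a); pose y (t : R) := b + t * (b' - b).
  have xy0 t : x t != 0 \/ y t != 0.
    have [/eqP xt|] := boolP (x t == 0); last by left.
    have [/eqP yt|] := boolP (y t == 0); last by right.
    case/negP: det; apply/eqP; rewrite /x /y in xt yt.
    transitivity ((a + t * (a' - a)) * (b' - b) - (b + t * (b' - b)) * (a' - a)).
      by ring.
    by rewrite xt yt; ring.
  have [[t [Et Ft]]|nEF] := pselect (exists t, E (x t) (y t) /\ F (x t) (y t)).
    exact: good Et Ft.
  have E00 : E (x 0) (y 0) by rewrite /x /y !mul0r !addr0.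
  have F11 : F (x 1) (y 1) by rewrite /x /y !mul1r ![_ + (_ - _)]addrC !subrK.
  have /choice[t tP] : forall n : nat, exists t : R, [/\ 0 <= t <= 1, E (x t) (y t)
      & F (x (t + n.+1%:R^-1)) (y (t + n.+1%:R^-1))].
    (* Just before the first sample point that satisfies [F], the condition [E] holds. *)
    move=> n; pose g (i : nat) : R := i%:R / n.+1%:R.
    have exF : exists i, `[< F (x (g i)) (y (g i)) >].
      by exists n.+1; apply/asboolP; rewrite /g divff ?pnatr_eq0.
    case: (ex_minnP exF) => -[|i] /asboolP Fi imin.
      by case: nEF; exists 0; split=> //; move: Fi; rewrite /g mul0r.
    have iN : (i <= n)%N.
      rewrite -ltnS; apply: imin; apply/asboolP.
      by rewrite /g divff ?pnatr_eq0.
    exists (g i); split.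
    - rewrite divr_ge0 //= ler_pdivrMr ?ltr0n // mul1r ler_nat.
      exact: leq_trans iN _.
    - have [//|Fi'] := EF _ _ (xy0 (g i)).
      by have := imin i (introT (asboolP _) Fi'); rewrite ltnn.
    - by have -> : g i + n.+1%:R^-1 = g i.+1 by rewrite /g -[i.+1]addn1 natrD mulrDl mul1r.
  have [U [UU oU]] := ultra_exists.
  have [l tl] : exists l : R, t n @[n --> U] --> l.
    apply: (@ultra_cvg _ _ _ 1) => //; apply: filterE => n.
    by have [/andP[h1 h2] _ _] := tP n; rewrite /= ger0_norm.
  have tl' : t n + n.+1%:R^-1 @[n --> U] --> l.
    by rewrite -[l]addr0; apply: cvgD => //; exact: ultra_harmonic.
  have aff (u v : R) (w : nat -> R) : w n @[n --> U] --> l ->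
      u + w n * v @[n --> U] --> u + l * v.
    by move=> wl; apply: cvgD; [exact: cvg_cst|apply: cvgM => //; exact: cvg_cst].
  case: nEF; exists l; split.
    by apply: (separated_lim UU nB nA r1 p'1 (aff _ _ _ tl) (aff _ _ _ tl)) => n; have [] := tP n.
  by apply: (separated_lim UU nA nB p1 r'1 (aff _ _ _ tl') (aff _ _ _ tl')) => n; have [] := tP n.
(* The segment between proportional directions may pass through 0. The detour through the orthogonal
   direction has a half leading from [E] to [F]. *)
have [det|det] := eqVneq (a0 * b1 - b0 * a1) 0; last exact: path det E0 F1.
have sq0 (u v : R) : u != 0 \/ v != 0 -> u * u + v * v != 0.
  move=> uv; rewrite -!expr2 paddr_eq0 ?sqr_ge0 // !sqrf_eq0.
  by case: uv => /negbTE->; rewrite ?andbF.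
have n2 : - b0 != 0 \/ a0 != 0.
  by rewrite oppr_eq0; case: n0; [right|left].
have [E2|F2] := EF _ _ n2; last first.
  by apply: path E0 F2; rewrite mulrN opprK sq0.
apply: path E2 F1.
apply/eqP => det'.
have e1 : (a0 * a0 + b0 * b0) * a1 = 0.
  transitivity (- a0 * (- b0 * b1 - a0 * a1) - b0 * (a0 * b1 - b0 * a1)); first by ring.
  by rewrite det det'; ring.
have e2 : (a0 * a0 + b0 * b0) * b1 = 0.
  transitivity (- b0 * (- b0 * b1 - a0 * a1) + a0 * (a0 * b1 - b0 * a1)); first by ring.
  by rewrite det det'; ring.
move/eqP: e1; move/eqP: e2; rewrite !mulf_eq0 !(negbTE (sq0 _ _ n0)) /= => b10 a10.
by case: n1; rewrite ?a10 ?b10.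
Qed.

(** * A Sperner lemma on a rectangle *)

Variant color := Left | Right | Up.

(* Steps in the cyclic order [Left], [Right], [Up]; the sum around a square
   vanishes unless all three colours occur on it. *)
Definition color_step (c d : color) : int :=
  match c, d with
  | Left, Right | Right, Up | Up, Left => 1
  | Right, Left | Up, Right | Left, Up => - 1
  | _, _ => 0
  end.

Definition tricolored (c d e f : color) : Prop :=
  forall k, [\/ k = c, k = d, k = e | k = f].

Lemma color_step_square (c d e f : color) :
  ~ tricolored c d e f ->
  color_step c d + color_step d f = color_step c e + color_step e f.
Proof.
move=> tri; have miss : exists k, [/\ k <> c, k <> d, k <> e & k <> f].
  apply: contrapT => nk; apply: tri => k; apply: contrapT => nkP.
  by apply: nk; exists k; split=> h; apply: nkP; [constructor 1|constructor 2|
    constructor 3|constructor 4].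
by case: miss => -[] [] ; case: c {tri}; case: d; case: e; case: f.
Qed.

(** Without a tricoloured square all rows have the same sum of steps. Lifting colours to integers
    evaluates it: the bottom row, which avoids [Up], gives 1, while the top row, where [Left] and
    [Right] are never adjacent, gives -2. *)
Lemma sperner_rectangle (c : nat -> nat -> color) (m n : nat) :
  (0 < m)%N ->
  (forall j, (j <= n)%N -> c 0%N j = Left) ->
  (forall j, (j <= n)%N -> c m j = Right) ->
  (forall i, (i <= m)%N -> c i 0%N <> Up) ->
  (forall i, (i < m)%N -> c i n = Up \/ c i.+1 n = Up \/ c i n = c i.+1 n) ->
  exists i j, [/\ (i < m)%N, (j < n)%N &
    tricolored (c i j) (c i.+1 j) (c i j.+1) (c i.+1 j.+1)].
Proof.
move=> m0 left right bottom top; apply: contrapT => ntri.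
pose row j := \sum_(0 <= i < m) color_step (c i j) (c i.+1 j).
have rowS j : (j < n)%N -> row j.+1 = row j.
  move=> jn.
  have : \sum_(0 <= i < m) (color_step (c i.+1 j) (c i.+1 j.+1)
      - color_step (c i j) (c i j.+1)) = 0.
    rewrite (telescope_sumr (fun i => color_step (c i j) (c i j.+1))) //.
    by rewrite !left ?right ?(ltnW jn).
  move=> e; apply: subr0_eq; rewrite /row -sumrB -[RHS]e.
  apply: eq_big_nat => i /andP[_ im].
  have := @color_step_square (c i j) (c i.+1 j) (c i j.+1) (c i.+1 j.+1) _.
  move=> h; have {}h := h (fun tri => ntri (ex_intro _ i (ex_intro _ j (And3 im jn tri)))).
  lia.
have row0 : row n = row 0%N.
  have : (n <= n)%N by []; elim: {-2}n => // j IH jn.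
  by rewrite rowS // IH // ltnW.
pose phi0 c := if c is Right then 1%Z else 0%Z.
pose phi1 c := match c with Left => 0 | Right => -2%:Z | Up => -1 end.
have e0 : row 0%N = 1.
  rewrite /row (eq_big_nat _ _ (F2 := fun i => phi0 (c i.+1 0%N) - phi0 (c i 0%N))).
    by rewrite telescope_sumr // left // right.
  move=> i /andP[_ im]; have := bottom i (ltnW im); have := bottom i.+1 im.
  by case: (c i 0%N); case: (c i.+1 0%N).
have e1 : row n = -2%:Z.
  rewrite /row (eq_big_nat _ _ (F2 := fun i => phi1 (c i.+1 n) - phi1 (c i n))).
    by rewrite telescope_sumr // left // right.
  move=> i /andP[_ im]; have := top i im.
  by case: (c i n); case: (c i.+1 n) => // -[|[]].
by move: row0; rewrite e0 e1.
Qed.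

(* The inf-convolution of [f] with the distance of the grid. *)
Lemma lipschitz_minorant (f : nat -> nat -> nat) :
  exists g : nat -> nat -> nat, [/\ forall i j, (g i j <= f i j)%N,
    forall i j i' j', (g i j <= g i' j' + (`|i - i'| + `|j - j'|))%N
  & forall i j, exists i' j', g i j = (f i' j' + (`|i - i'| + `|j - j'|))%N].
Proof.
pose P i j k := exists i' j', k = (f i' j' + (`|i - i'| + `|j - j'|))%N.
have /choice[g gP] : forall ij : nat * nat, exists k, P ij.1 ij.2 k /\
    forall k', P ij.1 ij.2 k' -> (k <= k')%N.
  move=> [i j] /=; have ex : exists k, `[< P i j k >].
    by exists (f i j + (`|i - i| + `|j - j|))%N; apply/asboolP; exists i, j.
  case: (ex_minnP ex) => k /asboolP Pk kmin.
  by exists k; split=> // k' Pk'; apply: kmin; exact/asboolP.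
exists (fun i j => g (i, j)); split.
- move=> i j; have [_ /(_ (f i j))] := gP (i, j); apply.
  by exists i, j => /=; lia.
- move=> i j i' j'; have [_ min] := gP (i, j).
  have [[k [l ->]] _] := gP (i', j') => /=.
  have := min (f k l + (`|i - k| + `|j - l|))%N; rewrite /P /= => h.
  have {}h : (g (i, j) <= f k l + (`|i - k| + `|j - l|))%N by apply: h; exists k, l.
  lia.
- by move=> i j; have [] := gP (i, j).
Qed.

(** * The fan *)

(** The indices [l <= n.*2] sample the range of openings from -1 to 1 with step [1 / n]. *)
Definition level (R : realType) (n l : nat) : R := l%:R / n%:R - 1.

Lemma level_itv (R : realType) (n l : nat) :
  (0 < n)%N -> (l <= n.*2)%N -> -1 <= level R n l <= 1.
Proof.
move=> n0 ln; rewrite /level lerBrDr addNr divr_ge0 //= lerBlDr.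
by rewrite ler_pdivrMr ?ltr0n // -[1 + 1]/(2%:R) -natrM ler_nat mul2n.
Qed.

Lemma level_dist (R : realType) (n l k d : nat) :
  (0 < n)%N -> (l <= k + d)%N -> (k <= l + d)%N ->
  `|level R n l - level R n k| <= d%:R / n%:R.
Proof.
move=> n0 lk kl; rewrite /level opprB addrA subrK -mulrBl normrM normfV.
rewrite normr_nat ler_wpM2r ?invr_ge0 // ler_norml.
rewrite lerBlDr -natrD ler_nat addnC lk andbT lerNl opprB lerBlDr -natrD ler_nat.
by rewrite addnC.
Qed.

Lemma wedge_halfplane (R : realType) (a b x h s : R) (q : plane R) :
  wedge a b x h s q -> halfplane a b x q.
Proof. by case. Qed.

Lemma halfplane_wedge (R : realType) (a b x h s : R) (q : plane R) :
  0 <= s -> s <= 1 -> s = 1 \/ (1 - `|h|) * lin 0 1 q <= h ->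
  halfplane a b x q -> wedge a b x h s q.
Proof.
move=> s0 s1 hs xq; split=> //; rewrite /phi.
have h1 : s * (lin a b q - x) <= 0 by rewrite mulr_ge0_le0 // subr_le0.
case: hs => [->|hq]; first by rewrite normr1 subrr mul0r addr0 mul1r subr_le0.
rewrite -[leRHS]addr0 lerD // mulr_ge0_le0 ?subr_le0 //.
by rewrite subr_ge0 ger0_norm.
Qed.

(** [f] is the least level at which the wedge is rich, [n.*2] by default, and [g] its Lipschitz
    minorant. Two facts survive: below [g] no wedge is rich, and [g] equals, up to the distance
    paid, a level that is rich or the default at another grid point. *)
Lemma wedge_levels (R : realType) (B : {fset set (plane R)}) (a b r : R)
    (x h : nat -> R) (n : nat) :
  exists g : nat -> nat -> nat, [/\ forall i j, (g i j <= n.*2)%N,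
    forall i j l, (l < g i j)%N -> ~ rich B (wedge a b (x i) (h j) (level R n l)) r,
    forall i j i' j', (g i j <= g i' j' + (`|i - i'| + `|j - j'|))%N
  & forall i j, exists i' j' k : nat, [/\ g i j = (k + (`|i - i'| + `|j - j'|))%N &
     k = n.*2 \/ rich B (wedge a b (x i') (h j') (level R n k)) r]].
Proof.
have /choice[f fP] : forall ij : nat * nat, exists k,
    [/\ (k <= n.*2)%N,
        k = n.*2 \/ rich B (wedge a b (x ij.1) (h ij.2) (level R n k)) r
      & forall l, (l < k)%N ->
          ~ rich B (wedge a b (x ij.1) (h ij.2) (level R n l)) r].
  move=> [i j] /=; pose P l := (l == n.*2) ||
    `[< rich B (wedge a b (x i) (h j) (level R n l)) r >].
  have ex : exists l, P l by exists n.*2; rewrite /P eqxx.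
  case: (ex_minnP ex) => k Pk kmin; exists k; split.
  - by apply: kmin; rewrite /P eqxx.
  - by case/orP: Pk => [/eqP|/asboolP]; [left|right].
  - move=> l lk rl; have : P l by rewrite /P; apply/orP; right; apply/asboolP.
    by move/kmin; rewrite leqNgt lk.
have [g [gf gL gE]] := lipschitz_minorant (fun i j => f (i, j)).
exists g; split.
- by move=> i j; rewrite (leq_trans (gf i j)) //; have [] := fP (i, j).
- move=> i j l lg; have [_ _] := fP (i, j); apply.
  exact: leq_trans lg (gf i j).
- exact: gL.
- move=> i j; have [i' [j' e]] := gE i j; exists i', j', (f (i', j')); split=> //.
  by have [] := fP (i', j').
Qed.

(** Without such a margin the opposite halfplanes at [x - 1 / (n + 1)] would all be rich in [A],
    hence also their limit, and [x] would separate. *)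
Lemma halfplane_lim_left (R : realType) (A B : {fset set (plane R)})
    (a b x p p' r : R) :
  nice A -> a != 0 \/ b != 0 -> 0 < p -> p * p' <= #|` A|%:R - 1 ->
  rich B (halfplane a b x) r -> ~ separated B A r p' a b ->
  exists2 d, 0 < d & rich A (halfplane a b (x - d)) p.
Proof.
move=> nA ab p0 pp' rB nsep; apply: contrapT => nd; apply: nsep.
exists x; split=> //; have [U [UU oU]] := ultra_exists.
apply: (@halfplane_lim _ U _ (fun=> - a) (fun=> - b) (fun n => - (x - n.+1%:R^-1)));
  try exact: cvg_cst.
  rewrite -[X in _ --> - X]subr0; apply: cvgN; apply: cvgB; first exact: cvg_cst.
  exact: ultra_harmonic.
apply: filterE => n.
have [rA|//] := halfplane_cover (x - n.+1%:R^-1) nA ab p0 pp'.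
by case: nd; exists n.+1%:R^-1 => //; rewrite invr_gt0.
Qed.

(** Piecewise affine with its break at index [N], placed at [x1], so that the index shows the side
    of [x1]. The last clause keeps the indices with [x i <= x2] far from the right end. *)
Lemma grid_abscissas (R : realType) (x1 x2 d : R) (N : nat) :
  (0 < N)%N -> 0 < d -> x1 <= x2 ->
  let w := x2 - x1 + d in
  exists x : nat -> R,
    [/\ forall i i', `|x i - x i'| <= (d + w) * `|i - i'|%:R / N%:R,
        forall i, (x i < x1) = (i < N)%N,
        x N = x1,
        forall i, (i <= N.*2)%N -> x1 - d <= x i <= x2 + d
      & [/\ x 0%N = x1 - d, x N.*2 = x2 + d &
         forall i, x i <= x2 -> d * N%:R <= w * (N.*2%:R - i%:R)]].
Proof.
move=> N0 d0 x12 w.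
have w0 : 0 < w by rewrite /w; lra.
have N0' : 0 < N%:R :> R by rewrite ltr0n.
pose x i := x1 - d * ((N - i)%:R / N%:R) + w * ((i - N)%:R / N%:R).
have xl i : (i <= N)%N -> x i = x1 - d * ((N - i)%:R / N%:R).
  by rewrite /x -subn_eq0 => /eqP->; rewrite mul0r mulr0 addr0.
have xr i : (N <= i)%N -> x i = x1 + w * ((i - N)%:R / N%:R).
  by rewrite /x -subn_eq0 => /eqP->; rewrite mul0r mulr0 subr0.
have frac1 i : (i <= N)%N -> 0 <= (i%:R / N%:R : R) <= 1.
  by move=> iN; rewrite divr_ge0 //= ler_pdivrMr // mul1r ler_nat.
exists x; split.
- move=> i i'; have e : x i - x i' = d * (((N - i')%:R - (N - i)%:R) / N%:R)
      + w * (((i - N)%:R - (i' - N)%:R) / N%:R) by rewrite /x; ring.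
  have key (u v : nat) : (u <= v + `|i - i'|)%N -> (v <= u + `|i - i'|)%N ->
      `|(u%:R - v%:R) / N%:R| <= `|i - i'|%:R / N%:R :> R.
    move=> uv vu; rewrite normrM normfV normr_nat ler_wpM2r ?invr_ge0 //.
    rewrite ler_norml lerBlDr -natrD ler_nat addnC uv andbT.
    by rewrite lerNl opprB lerBlDr -natrD ler_nat addnC.
  rewrite e (le_trans (ler_normD _ _)) // -[leRHS]mulrA [leRHS]mulrDl !(normrM d) !(normrM w).
  rewrite (ger0_norm (ltW d0)) (ger0_norm (ltW w0)).
  by rewrite lerD // ler_pM2l // key //; lia.
- move=> i; case: (ltnP i N) => iN.
    by rewrite xl ?(ltnW iN) // gtrDl oppr_lt0 mulr_gt0 // divr_gt0 // ltr0n subn_gt0.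
  by apply/negbTE; rewrite -leNgt xr // lerDl mulr_ge0 ?(ltW w0) // divr_ge0.
- by rewrite xl // subnn mul0r mulr0 subr0.
- move=> i i2; case: (leqP i N) => iN.
    rewrite xl //; have /andP[h1 h2] := frac1 (N - i)%N (leq_subr _ _).
    have := ler_wpM2l (ltW d0) h2; have := mulr_ge0 (ltW d0) h1; lra.
  rewrite xr ?(ltnW iN) //; have /andP[h1 h2] : 0 <= ((i - N)%:R / N%:R : R) <= 1 by apply: frac1; lia.
  have := ler_wpM2l (ltW w0) h2; have := mulr_ge0 (ltW w0) h1; rewrite /w; lra.
split.
- by rewrite xl // subn0 divff ?gt_eqF // mulr1.
- rewrite xr; last by lia.
  have -> : (N.*2 - N = N)%N by lia.
  by rewrite divff ?gt_eqF // mulr1 /w; ring.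
- move=> i; case: (leqP N i) => iN.
    rewrite xr // natrB // => h.
    have {h} : w * ((i%:R - N%:R) / N%:R) <= w - d by rewrite /w in h *; lra.
    rewrite mulrA ler_pdivrMr // -[N.*2]addnn natrD; lra.
  move=> _; have h : i%:R <= N%:R :> R by rewrite ler_nat ltnW.
  rewrite -addnn natrD; have := ler_wpM2l (ltW w0) h.
  have : d * N%:R <= w * N%:R by rewrite ler_wpM2r // /w; lra.
  lra.
Qed.

(** The last height is [N / (N + 2)]. It stands for an apex at height [N / 2], no lower than any
    crossing once [2 * M <= N]. *)
Lemma grid_heights (R : realType) (M : R) (N : nat) :
  (0 < N)%N -> 0 <= M -> 2 * M <= N%:R ->
  exists h : nat -> R,
    [/\ forall j j', `|h j - h j'| <= 2 * `|j - j'|%:R / N%:R,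
        forall j, (j <= N)%N -> `|h j| < 1,
        h 0%N <= -1 + 2 / N%:R
      & forall y, y <= M -> (1 - `|h N|) * y <= h N].
Proof.
move=> N0 M0 MN.
have N0' : 0 < N%:R :> R by rewrite ltr0n.
have N2 : 0 < N%:R + 2 :> R by lra.
pose h (j : nat) : R := -1 + 2 * (j.+1%:R / (N%:R + 2)).
have inv : (N%:R + 2)^-1 <= N%:R^-1 :> R by rewrite lef_pV2 ?posrE //; lra.
have hN : h N = 1 - 2 / (N%:R + 2).
  by rewrite /h -natr1; field; lra.
exists h; split.
- move=> j j'; have -> : h j - h j' = 2 * ((j%:R - j'%:R) / (N%:R + 2)).
    by rewrite /h -!natr1; field; lra.
  rewrite -mulrA normrM ger0_norm // ler_pM2l //.
  rewrite normrM normfV (gtr0_norm N2) ler_pM ?invr_ge0 ?(ltW N2) //.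
  rewrite ler_norml lerBlDr -natrD ler_nat lerNl opprB lerBlDr -natrD ler_nat.
  by lia.
- move=> j jN; have j1 : 0 < j.+1%:R / (N%:R + 2) :> R by rewrite divr_gt0.
  have j2 : j.+1%:R / (N%:R + 2) < 1 :> R.
    by rewrite ltr_pdivrMr // mul1r -[2]/(2%:R) -natrD ltr_nat; lia.
  by rewrite /h ltr_norml; lra.
- by rewrite /h mul1r; lra.
- have i0 : 0 < (N%:R + 2)^-1 :> R by rewrite invr_gt0.
  have i1 : (N%:R + 2) * (N%:R + 2)^-1 = 1 :> R by rewrite mulfV // gt_eqF.
  have N1 : 1 <= N%:R :> R by rewrite ler1n.
  have hN0 : 0 <= h N.
    have := mulr_ge0 (ltW i0) (_ : 0 <= N%:R); rewrite hN; lra.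
  move=> y yM; rewrite (ger0_norm hN0) hN.
  have := ler_wpM2l (ltW i0) yM; have := ler_wpM2l (ltW i0) MN; lra.
Qed.

Ltac nat_lia :=
  repeat match goal with H : ?P |- _ =>
    lazymatch P with
    | is_true (leq _ _) => fail
    | @eq nat _ _ => fail
    | nat => fail
    | _ => clear H
    end end; lia.

(* [x], [h] and [s], [t] are the apices and the opening parameters of three
   nearby fans, one for each colour of a tricoloured square.  The wedges are
   rich in [B] only after moving the fan by at most [e], because the parameters
   come from an inf-convolution. *)
Definition fan_approx (R : realType) (A B : {fset set (plane R)})
    (a b x1 x2 d p1 p2 p3 r1 r2 r3 e e' : R) (x h s t : color -> R) : Prop :=
  [/\ forall k, [/\ x1 - d <= x k <= x2 + d, `|h k| <= 1, -1 <= s k <= 1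
        & -1 <= t k <= 1],
      forall k k', [/\ `|x k - x k'| <= e, `|h k - h k'| <= e,
        `|s k - s k'| <= e & `|t k - t k'| <= e],
      exists y g u, [/\ `|y - x Right| <= e, `|g - h Right| <= e, -1 <= u,
        u <= s Right & u = 1 \/ rich B (wedge a b y g u) r1],
      exists y g u, [/\ `|y - x Right| <= e, `|g - h Right| <= e, -1 <= u,
        u <= t Right & u = 1 \/ rich B (wedge (- a) (- b) (- y) g u) r2]
    & [/\ x1 - e <= x Up, x Up <= x2 + e,
          h Left <= -1 + e \/
            rich A (wedge a b (x Left) (h Left) (s Left)) p1,
          [/\ rich A (wedge (- a) (- b) (- x Right) (h Right) (t Right)) p2,
            0 <= s Right + t Right
            & -1 + e <= s Right -> -1 + e <= t Right -> rich B (top a b (x Right)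
              (h Right) (s Right - e') (t Right - e')) r3]
        & s Up + t Up <= e' \/
            rich A (top a b (x Up) (h Up) (s Up) (t Up)) p3]].

Section FanApproximation.
Context (R : realType) (A B : {fset set (plane R)}).
Context (a b x1 x2 d M p1 p2 p3 r1 r2 r3 : R) (n : nat).
Hypotheses (nA : nice A) (nB : nice B) (a0 : a != 0).
Hypotheses (crA : {in A, forall l, crosses a b l}).
Hypotheses (crB : {in B, forall l, crosses a b l}).
Hypotheses (p10 : 0 < p1) (p20 : 0 < p2) (ppp : p1 * p2 * p3 <= #|` A|%:R / 2).
Hypotheses (r10 : 0 < r1) (r20 : 0 < r2) (rrr : r1 * r2 * r3 <= #|` B|%:R / 2).
Hypotheses (d0 : 0 < d) (x12 : x1 <= x2) (M0 : 0 <= M).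
Hypotheses (MA : forall q, intersection_points A q -> lin 0 1 q <= M).
Hypotheses (MB : forall q, intersection_points B q -> lin 0 1 q <= M).
Hypotheses (B1 : rich B (halfplane a b x1) r1).
Hypotheses (B1min : forall c, rich B (halfplane a b c) r1 -> x1 <= c).
Hypotheses (B2 : rich B (halfplane (- a) (- b) (- x2)) r2).
Hypotheses (B2min : forall c, rich B (halfplane (- a) (- b) c) r2 -> - x2 <= c).
Hypotheses (A1 : rich A (halfplane a b (x1 - d)) p1).
Hypotheses (A2 : rich A (halfplane (- a) (- b) (- (x2 + d))) p2).
Hypotheses (n1 : (1 < n)%N) (nd : 2 * (x2 - x1 + d) <= d * n%:R).
Hypotheses (nM : 2 * M <= n%:R).

Let w := x2 - x1 + d.
(** The inf-convolution may shift an apex by up to [2 n] indices; with [n ^ 2] steps this is a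
    displacement of order [1 / n]. [C] dominates the constants for abscissas, heights and levels. *)
Let N := (n * n)%N.
Let C := 2 * (d + w) + 4.

Lemma fan_approximation : exists x h s t,
  fan_approx A B a b x1 x2 d p1 p2 p3 r1 r2 r3 (C / n%:R) n%:R^-1 x h s t.
Proof.
have n0 : (0 < n)%N by nat_lia.
have n0' : 0 < n%:R :> R by rewrite ltr0n.
have N0 : (0 < N)%N by rewrite muln_gt0 n0.
have NE : N%:R = n%:R * n%:R :> R by rewrite natrM.
have w0 : 0 < w by rewrite ltr_wpDl // subr_ge0.
have [x [xlip xlt xN xitv [x0 xm xle2]]] := grid_abscissas N0 d0 x12.
rewrite -/w in xlip xle2.
have MN : 2 * M <= N%:R by rewrite (le_trans nM) // ler_nat leq_pmulr.
have [h [hlip h1 h0 htop]] := grid_heights N0 M0 MN.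
have [gs [gs_le gs_min gs_lip gsE]] := wedge_levels B a b r1 x h n.
have [gt [gt_le gt_min gt_lip gtE]] :=
  wedge_levels B (- a) (- b) r2 (fun i => - x i) h n.
pose s i j := level R n (gs i j); pose t i j := level R n (gt i j).
pose H1 i j := `[< rich A (wedge a b (x i) (h j) (s i j)) p1 >].
pose H2 i j := `[< rich A (wedge (- a) (- b) (- x i) (h j) (t i j)) p2 >].
pose m := N.*2.
(* The first three cases settle the bottom row and the two sides. [Up] is imposed when the top is
   straight up to [1 / n], so that elsewhere the fan remains convex with both levels lowered by one.
   The last cases name a part rich in [A], the top by [fan_cover] if neither wedge is; the priority
   changes at [N] for the sake of the top row. *)
pose col i j :=
  if (j == 0)%N && (i < m)%N then Left
  else if (i < N)%N && (gs i j == n.*2) then Left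
  else if (x2 < x i) && (gt i j == n.*2) then Right
  else if (gs i j + gt i j <= n.*2.+1)%N then Up
  else if (i < N)%N then (if H1 i j then Left else if H2 i j then Right else Up)
  else (if H2 i j then Right else if H1 i j then Left else Up).
have levD l : level R n (l + n) = l%:R / n%:R.
  by rewrite /level natrD mulrDl divff ?gt_eqF // addrK.
have rA1 i j : (i <= m)%N -> 0 <= s i j -> s i j = 1 \/ j = N -> H1 i j.
  move=> im si sj; apply/asboolP.
  have /andP[_ s1] := level_itv R n0 (gs_le i j).
  have /andP[xi _] := xitv i im.
  apply: richS A1; last exact: lexx.
  move=> q Iq hq; apply: halfplane_wedge => //.
    by case: sj => [|->]; [left|right; apply/htop/MA].
  exact: le_trans hq xi.
have rA2 i j : (i <= m)%N -> 0 <= t i j -> t i j = 1 \/ j = N -> H2 i j.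
  move=> im ti tj; apply/asboolP.
  have /andP[_ t1] := level_itv R n0 (gt_le i j).
  have /andP[_ xi] := xitv i im.
  apply: richS A2; last exact: lexx.
  move=> q Iq hq; apply: halfplane_wedge => //.
    by case: tj => [|->]; [left|right; apply/htop/MA].
  by apply: le_trans hq _; rewrite lerN2.
have lev1 : level R n n.*2 = 1.
  by rewrite -addnn levD divff // gt_eqF.
(* A value below the default comes from a rich wedge nearby, and by minimality of [x1] that wedge is
   not left of [x1]. *)
have gs_near i j : (gs i j < n.*2)%N -> exists2 i', (N <= i')%N & (`|i - i'| < n.*2)%N.
  have [i' [j' [k [-> [->|rk]]]]] := gsE i j; first by nat_lia.
  move=> lt; exists i'; last by nat_lia.
  rewrite leqNgt -xlt -leNgt; apply: B1min.
  by apply: richS rk => // q _ /wedge_halfplane.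
have gt_near i j : (gt i j < n.*2)%N -> exists2 i', x i' <= x2 & (`|i - i'| < n.*2)%N.
  have [i' [j' [k [-> [->|rk]]]]] := gtE i j; first by nat_lia.
  move=> lt; exists i'; last by nat_lia.
  rewrite -lerN2; apply: B2min.
  by apply: richS rk => // q _ /wedge_halfplane.
have nN : (n.*2 <= N)%N by rewrite /N -muln2 leq_mul2l n1 orbT.
have left0 j : gs 0 j = n.*2.
  apply/eqP; rewrite eqn_leq gs_le leqNgt; apply/negP => /gs_near[i' Ni' di'].
  by nat_lia.
have rightm j : gt m j = n.*2.
  apply/eqP; rewrite eqn_leq gt_le leqNgt; apply/negP => /gt_near[i' xi' di'].
  have := xle2 i' xi'; rewrite -/m NE.
  have : m%:R - i'%:R < n.*2%:R :> R.
    by rewrite ltrBlDr -natrD ltr_nat; nat_lia.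
  move: nd; rewrite -/w -mul2n natrM => nd' hm he.
  have h2 := ler_wpM2r (ltW n0') nd'.
  have h3 : w * (m%:R - i'%:R) < w * (2 * n%:R) by rewrite ltr_pM2l.
  by lra.
have xlt2 i : (i < N)%N -> x i <= x2 by rewrite -xlt => /ltW/le_trans; apply.
have colL j : (j <= N)%N -> col 0%N j = Left.
  by move=> jN; rewrite /col left0 eqxx N0; case: ifP.
have colR j : (j <= N)%N -> col m j = Right.
  have mN : (m < N)%N = false by rewrite ltnNge /m -addnn leq_addr.
  by move=> jN; rewrite /col ltnn andbF rightm eqxx xm ltrDl d0 mN.
have colB i : (i <= m)%N -> col i 0%N <> Up.
  rewrite leq_eqVlt => /orP[/eqP->|im]; first by rewrite colR.
  by rewrite /col im.
(* With the apex above all crossings, a horizontal ray (level [n]) does as well as the halfplane,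
   which is rich from [x1] on. *)
have gs_top i : (N <= i)%N -> (gs i N <= n)%N.
  move=> Ni; rewrite leqNgt; apply/negP => /gs_min; apply.
  rewrite -[X in level _ _ X]add0n levD mul0r; apply: richS B1; last exact: lexx.
  move=> q Iq hq; apply: halfplane_wedge => //; first by right; apply/htop/MB.
  by apply: le_trans hq _; rewrite leNgt xlt -leqNgt.
have gt_top i : x i <= x2 -> (gt i N <= n)%N.
  move=> xi; rewrite leqNgt; apply/negP => /gt_min; apply.
  rewrite -[X in level _ _ X]add0n levD mul0r; apply: richS B2; last exact: lexx.
  move=> q Iq hq; apply: halfplane_wedge => //; first by right; apply/htop/MB.
  by apply: le_trans hq _; rewrite lerN2.
have lev0 l : (n <= l)%N -> 0 <= level R n l.
  by move=> nl; rewrite -(subnK nl) levD divr_ge0.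
(* Here [t <= 0], so either the top is nearly straight or [s >= 0], and then the left wedge is rich
   in [A]. At index [N] both openings are at most 0, so [Up] separates [Left] from [Right]. *)
have colT1 i : (i < N)%N -> col i N = Left \/ col i N = Up.
  move=> iN; rewrite /col iN (gtn_eqF N0) /=; case: ifP => _; first by left.
  rewrite ltNge xlt2 //=; case: leqP => hl; first by right.
  rewrite rA1; first by left.
  - by rewrite /m; nat_lia.
  - by apply: lev0; have := gt_top i (xlt2 i iN); nat_lia.
  - by right.
have colT2 i : (N <= i)%N -> (i <= m)%N -> col i N = Right \/ col i N = Up.
  move=> Ni im; rewrite /col (leq_gtF Ni) (gtn_eqF N0) /=.
  case: ifP => _; first by left.
  case: leqP => hl; first by right.
  rewrite rA2 //; [by left|by apply: lev0; have := gs_top i Ni; nat_lia|by right].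
have colTN : col N N = Up.
  rewrite /col (gtn_eqF N0) ltnn /= xN ltNge x12 /=.
  have := gs_top N (leqnn N); have := gt_top N.
  by rewrite xN => /(_ x12) h2 h3; case: leqP => //; nat_lia.
have m0 : (0 < m)%N by rewrite /m; nat_lia.
have [|i0 [j0 [i0m j0N tri]]] := sperner_rectangle m0 colL colR colB.
  move=> i im; case: (ltngtP i.+1 N) => iN.
  - have [->|] := colT1 i (ltnW iN); last by left.
    by have [->|] := colT1 i.+1 iN; [right; right|right; left].
  - have [->|] := colT2 i iN (ltnW im); last by left.
    by have [->|] := colT2 i.+1 (leqW iN) im; [right; right|right; left].
  - by right; left; rewrite iN.
have vert k : exists ij : nat * nat, [/\ (i0 <= ij.1 <= i0.+1)%N,
    (j0 <= ij.2 <= j0.+1)%N & col ij.1 ij.2 = k].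
  case: (tri k) => ->; [exists (i0, j0)|exists (i0.+1, j0)|exists (i0, j0.+1)|
    exists (i0.+1, j0.+1)]; split=> //=; nat_lia.
have /choice[v vP] := vert.
have vm k : ((v k).1 <= m)%N by have [] := vP k; nat_lia.
have vN k : ((v k).2 <= N)%N by have [] := vP k; nat_lia.
have vcol k : col (v k).1 (v k).2 = k by have [] := vP k.
have vdist k k' : (`|(v k).1 - (v k').1| <= 1)%N /\ (`|(v k).2 - (v k').2| <= 1)%N.
  by have [] := vP k; have [] := vP k'; nat_lia.
pose x' k := x (v k).1; pose h' k := h (v k).2.
pose s' k := s (v k).1 (v k).2; pose t' k := t (v k).1 (v k).2.
have n00 : 0 <= n%:R^-1 :> R by rewrite invr_ge0 ltW.
have C0 : 4 <= C by rewrite /C lerDr mulr_ge0 // addr_ge0 // ltW.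
have smallN (i i' : nat) : (`|i - i'| <= n.*2)%N -> `|i - i'|%:R / N%:R <= 2 / n%:R :> R.
  move=> di; rewrite NE invfM mulrA ler_wpM2r // ler_pdivrMr //.
  by rewrite -natrM ler_nat mul2n.
have small_x (i i' : nat) : (`|i - i'| <= n.*2)%N -> `|x i - x i'| <= C / n%:R.
  move=> di; rewrite (le_trans (xlip i i')) // -mulrA.
  apply: (@le_trans _ _ ((d + w) * (2 / n%:R))).
    by apply: ler_wpM2l; [rewrite ltW // addr_gt0|exact: smallN].
  by rewrite mulrA ler_wpM2r // /C mulrC lerDl.
have small_h (j j' : nat) : (`|j - j'| <= n.*2)%N -> `|h j - h j'| <= C / n%:R.
  move=> dj; rewrite (le_trans (hlip j j')) // -mulrA.
  apply: (@le_trans _ _ (2 * (2 / n%:R))).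
    by rewrite ler_pM2l // smallN.
  by rewrite mulrA ler_wpM2r // -natrM.
have small_lev l k : (l <= k + 2)%N -> (k <= l + 2)%N ->
    `|level R n l - level R n k| <= C / n%:R.
  move=> lk kl; rewrite (le_trans (level_dist _ n0 lk kl)) // ler_wpM2r //.
  by rewrite (le_trans _ C0) // ler_nat.
have convex_col k : k <> Left -> col (v k).1 (v k).2 = k -> k = Up \/
    (gt (v k).1 (v k).2 = n.*2 /\ x2 < x (v k).1) \/
    (n.*2.+2 <= gs (v k).1 (v k).2 + gt (v k).1 (v k).2)%N.
  move=> kL; rewrite {1}/col; case: ifP => [_ e|_]; first by case: kL.
  case: ifP => [_ e|_]; first by case: kL.
  case: ifP => [/andP[xx /eqP e] _|_]; first by right; left.
  case: (leqP (gs (v k).1 (v k).2 + gt (v k).1 (v k).2) n.*2.+1) => [_ e|_ _].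
    by left.
  by right; right.
exists x', h', s', t'; split.
- move=> k; split; first exact: xitv.
  + exact/ltW/h1.
  + exact: level_itv.
  + exact: level_itv.
- move=> k k'; have [d1 d2] := vdist k k'.
  have d3 := gs_lip (v k).1 (v k).2 (v k').1 (v k').2.
  have d4 := gs_lip (v k').1 (v k').2 (v k).1 (v k).2.
  have d5 := gt_lip (v k).1 (v k).2 (v k').1 (v k').2.
  have d6 := gt_lip (v k').1 (v k').2 (v k).1 (v k).2.
  split.
  + by apply: small_x; nat_lia.
  + by apply: small_h; nat_lia.
  + by apply: small_lev; nat_lia.
  + by apply: small_lev; nat_lia.
- have [i [j [k [gE kP]]]] := gsE (v Right).1 (v Right).2.
  have gle := gs_le (v Right).1 (v Right).2.
  exists (x i), (h j), (level R n k); split.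
  + by apply: small_x; nat_lia.
  + by apply: small_h; nat_lia.
  + by have /andP[] : -1 <= level R n k <= 1 by apply: level_itv => //; nat_lia.
  + rewrite /s' /s /level lerD2r ler_wpM2r // ler_nat; nat_lia.
  + by case: kP => [->|]; [left|right].
- have [i [j [k [gE kP]]]] := gtE (v Right).1 (v Right).2.
  have gle := gt_le (v Right).1 (v Right).2.
  exists (x i), (h j), (level R n k); split.
  + by apply: small_x; nat_lia.
  + by apply: small_h; nat_lia.
  + by have /andP[] : -1 <= level R n k <= 1 by apply: level_itv => //; nat_lia.
  + rewrite /t' /t /level lerD2r ler_wpM2r // ler_nat; nat_lia.
  + by case: kP => [->|]; [left|right].
have half2 l l' : (n.*2 <= l + l')%N -> 0 <= level R n l + level R n l'.
  move=> ll; have -> : level R n l + level R n l' = ((l + l')%:R - n.*2%:R) / n%:R.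
    by rewrite /level natrD -mul2n natrM; field; rewrite gt_eqF.
  by rewrite divr_ge0 // subr_ge0 ler_nat.
have Cn0 : 0 <= C / n%:R by rewrite mulr_ge0 // (le_trans _ C0).
split.
- have := vcol Up; rewrite /col; case: ifP => // _; case: ifP => // hUp _.
  rewrite /x' lerBlDr.
  have [Ni|iN] := leqP N (v Up).1.
    by rewrite (@le_trans _ _ (x (v Up).1)) ?lerDl // leNgt xlt -leqNgt.
  have [i' Ni' di'] : exists2 i', (N <= i')%N & (`|(v Up).1 - i'| < n.*2)%N.
    apply: (gs_near _ (v Up).2); rewrite ltn_neqAle gs_le andbT.
    by apply/negP => e; rewrite iN e in hUp.
  have := small_x _ _ (ltnW di'); rewrite ler_norml => /andP[h3 _].
  have x1i : x1 <= x i' by rewrite leNgt xlt -leqNgt.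
  rewrite (le_trans x1i) // -lerBlDl -lerN2 opprB; exact: h3.
- have := vcol Up; rewrite /col; case: ifP => // _; case: ifP => // _.
  case: ifP => // hUp _.
  have [xx|xx] := lerP (x (v Up).1) x2.
    by rewrite (le_trans xx) // lerDl.
  have [i' xi' di'] : exists2 i', x i' <= x2 & (`|(v Up).1 - i'| < n.*2)%N.
    apply: (gt_near _ (v Up).2); rewrite ltn_neqAle gt_le andbT.
    by apply/negP => e; rewrite xx e in hUp.
  have := small_x _ _ (ltnW di'); rewrite ler_norml => /andP[_ h3].
  by rewrite /x' -lerBlDl (le_trans _ h3) // lerD2l lerN2.
- have := vcol Left; rewrite /col; case: ifP => [/andP[/eqP e _] _|_].
    left; rewrite /h' e (le_trans h0) // lerD2l.
    rewrite NE invfM mulrA ler_wpM2r // (le_trans _ C0) //.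
    rewrite ler_pdivrMr // -[2]/(2%:R) -natrM ler_nat; nat_lia.
  case: ifP => [/andP[iN /eqP e] _|_].
    right; apply/asboolP/rA1; rewrite ?vm // /s e lev1 ?ler01 //; by left.
  case: ifP => // _; case: ifP => // _; case: ifP => // _.
    by case: ifP => [/asboolP|_]; [right|case: ifP].
  by case: ifP => // _; case: ifP => // /asboolP; right.
- have [//|//|cR] := convex_col Right _ (vcol Right).
  split.
  + have := vcol Right; rewrite /col; case: ifP => // _; case: ifP => // _.
    case: ifP => [/andP[_ /eqP e] _|_].
      by apply/asboolP/rA2; rewrite ?vm // /t e lev1 ?ler01 //; left.
    case: ifP => // _; case: ifP => // _.
      by case: ifP => // _; case: ifP => // /asboolP.
    by case: ifP => [/asboolP //|_]; case: ifP.
  + by apply: half2; case: cR => [[e _]|cR]; nat_lia.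
  (* One level lower neither wedge is rich in [B], so the top is. Lowered openings must stay above
     -1, whence [2 <= l]; the lowered fan is convex if the levels add up to [n.*2.+2], which holds
     by the colour or, when [gt] is maximal, by [2 <= gs]. *)
  + have lev2 l : -1 + C / n%:R <= level R n l -> (2 <= l)%N.
      rewrite /level addrC lerD2r ler_pM2r ?invr_gt0 // => Cl.
      have : 4 <= l%:R :> R by rewrite (le_trans C0).
      by rewrite (ler_nat R 4 l); nat_lia.
    move=> /lev2 gs2 /lev2 gt2.
    have pred l : (2 <= l)%N -> level R n l - n%:R^-1 = level R n l.-1.
      by case: l => // l _; rewrite /level -natr1 mulrDl mul1r; ring.
    rewrite /s' /t' /s /t !pred //.
    have gtm l : (2 <= l)%N -> (l <= n.*2)%N -> -1 < level R n l.-1 <= 1.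
      move=> l2 ln; have /andP[_ ->] : -1 <= level R n l.-1 <= 1.
        by apply: level_itv => //; nat_lia.
      rewrite andbT /level -subr_gt0 opprK subrK divr_gt0 // ltr0n; nat_lia.
    have [|||] := fan_cover (x (v Right).1) nB a0 crB (h1 _ (vN Right)) (gtm _ gs2 (gs_le _ _))
      (gtm _ gt2 (gt_le _ _)) _ r10 r20 rrr.
    * by apply: half2; case: cR => [[e _]|cR]; nat_lia.
    * by move/gs_min; case; nat_lia.
    * by move/gt_min; case; nat_lia.
    * by [].
- have := vcol Up; rewrite /col; case: ifP => // _; case: ifP => // _.
  case: ifP => // _.
  case: (leqP (gs (v Up).1 (v Up).2 + gt (v Up).1 (v Up).2) n.*2.+1) => hl.
    move=> _; left; rewrite /s' /t' /s /t.
    set l := gs _ _ in hl *; set l' := gt _ _ in hl *.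
    have -> : level R n l + level R n l' = ((l + l')%:R - n.*2%:R) / n%:R.
      by rewrite /level natrD -mul2n natrM; field; rewrite gt_eqF.
    rewrite ler_pdivrMr // mulVf ?gt_eqF // lerBlDl.
    by rewrite natr1 ler_nat.
  move=> hc; right.
  have [nH1 nH2] : ~ H1 (v Up).1 (v Up).2 /\ ~ H2 (v Up).1 (v Up).2.
    by move: hc; case: ifP => _; case: ifP => //; case: ifP.
  have glt l l' : (n.*2.+1 < l + l')%N -> (l' <= n.*2)%N -> (l <= n.*2)%N ->
      -1 < level R n l <= 1.
    move=> ll l'n ln; have /andP[_ ->] := level_itv R n0 ln.
    rewrite andbT /level -subr_gt0 opprK subrK divr_gt0 // ltr0n; nat_lia.
  have sl := glt _ _ hl (gt_le _ _) (gs_le _ _).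
  rewrite addnC in hl; have tl := glt _ _ hl (gs_le _ _) (gt_le _ _).
  have [|||] := fan_cover (x (v Up).1) nA a0 crA (h1 _ (vN Up)) sl tl _ p10 p20 ppp.
  + by apply: half2; nat_lia.
  + by move=> r; case: nH1; apply/asboolP.
  + by move=> r; case: nH2; apply/asboolP.
  + by [].
Qed.

End FanApproximation.

(** * Limits of approximate fans *)

(** At [s = -1] the wedge is the whole vertical line, which a wider wedge need not contain. *)
Lemma wedge_mono (R : realType) (a b x h s s' : R) (q : plane R) :
  -1 < s -> s <= s' -> s' <= 1 -> wedge a b x h s q -> wedge a b x h s' q.
Proof.
move=> s1 ss' s'1 [xq]; rewrite /phi => hq; split=> //; rewrite /phi.
move: hq; move: xq; rewrite -subr_le0.
move: (_ - x) ((1 - `|h|) * _ - h) => u g u0.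
case: (lerP g 0) => g0.
  case: (lerP 0 s') => s'0.
    move=> _; rewrite -[leRHS]addr0 lerD // mulr_ge0_le0 // subr_ge0.
    by rewrite ger0_norm.
  rewrite (ltr0_norm s'0) ltr0_norm; last exact: le_lt_trans s'0.
  move=> hs; have ug : u + g <= 0 by rewrite -[leRHS]addr0 lerD.
  have : (s' - s) * (u + g) <= 0 by rewrite mulr_ge0_le0 // subr_ge0.
  lra.
case: (lerP s 0) => s0.
  rewrite (ler0_norm s0) => hs.
  have h1 : 0 < (1 - - s) * g by rewrite mulr_gt0 //; lra.
  have h2 : 0 <= s * u by rewrite mulr_le0.
  lra.
rewrite (gtr0_norm s0) gtr0_norm; last exact: lt_le_trans s0 _.
move=> hs; have ug : u - g <= 0 by lra.
have : (s' - s) * (u - g) <= 0 by rewrite mulr_ge0_le0 // subr_ge0.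
lra.
Qed.

(** Among three lines crossing only on one vertical line, one would meet both others at its unique
    point there, and the three would be concurrent. *)
Lemma line_not_rich (R : realType) (B : {fset set (plane R)}) (a b x r : R) :
  nice B -> a != 0 -> {in B, forall l, crosses a b l} -> 2 < r ->
  ~ rich B [set q | lin a b q = x] r.
Proof.
move=> nB a0 cr r2 [L [/fsubsetP LB IL rL]].
have det : a * 1 - b * 0 != 0 by rewrite mulr0 mulr1 subr0.
have : (2 < #|` L|)%N by rewrite -(ltr_nat R) (lt_le_trans r2).
have [->|[l lL]] := fset_0Vmem L; first by rewrite cardfs0.
rewrite (cardfsD1 l) lL ltnS.
have [->|[m]] := fset_0Vmem (L `\ l); first by rewrite cardfs0.
rewrite in_fsetD1 => /andP[ml mL]; rewrite (cardfsD1 m) in_fsetD1 ml mL ltnS.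
rewrite cardfs_gt0 => /fset0Pn[n]; rewrite !in_fsetD1 => /and3P[nm nl nL].
have [q [lq mq]] := nice_meet nB (LB _ mL) (LB _ lL) ml.
have [q' [nq' lq']] := nice_meet nB (LB _ nL) (LB _ lL) nl.
have [_ _ conc] := nB.
have := conc m l n (LB _ mL) (LB _ lL) (LB _ nL) ml.
rewrite eq_sym nm eq_sym nl => /(_ isT isT) e.
suff qq' : q = q' by rewrite -[False]/(set0 q) -e; split=> //; rewrite qq'.
have [MK lP] := crosses_graph det (cr l (LB _ lL)).
have e1 : lin a b q = x by apply: IL; exists m, l; split.
have e2 : lin a b q' = x by apply: IL; exists n, l; split.
apply: (frame_inj det); first by rewrite e1 e2.
by rewrite (proj1 (lP q) mq) (proj1 (lP q') lq') e1 e2.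
Qed.

Lemma cvg_phi (R : realType) (U : set_system nat) (x h s : nat -> R)
    (x' h' s' u y : R) :
  Filter U -> x n @[n --> U] --> x' -> h n @[n --> U] --> h' ->
  s n @[n --> U] --> s' ->
  phi (x n) (h n) (s n) u y @[n --> U] --> phi x' h' s' u y.
Proof.
move=> FU hx hh hs; rewrite /phi.
have c z : z @[_ --> U] --> (z : R) by exact: cvg_cst.
apply: cvgD; apply: cvgM => //; first exact: cvgB.
  by apply: cvgB => //; exact: cvg_norm.
apply: cvgB => //; apply: cvgM => //; apply: cvgB => //; exact: cvg_norm.
Qed.

Lemma wedge_lim (R : realType) (U : set_system nat) (L : {fset set (plane R)})
    (a b p : R) (x h s : nat -> R) (x' h' s' : R) :
  UltraFilter U -> x n @[n --> U] --> x' -> h n @[n --> U] --> h' ->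
  s n @[n --> U] --> s' ->
  U [set n | rich L (wedge a b (x n) (h n) (s n)) p] ->
  rich L (wedge a b x' h' s') p.
Proof.
move=> UU hx hh hs rU; apply: (rich_lim UU rU) => q Uq.
have hc z : z @[_ --> U] --> (z : R) by exact: cvg_cst.
split.
  by apply: (ultra_le UU (hc _) hx); apply: filterS Uq => n [].
have hp : phi (x n) (h n) (s n) (lin a b q) (lin 0 1 q) @[n --> U]
    --> phi x' h' s' (lin a b q) (lin 0 1 q) by exact: cvg_phi.
by apply: (ultra_le UU hp (hc _)); apply: filterS Uq => n [].
Qed.

Lemma top_lim (R : realType) (U : set_system nat) (L : {fset set (plane R)})
    (a b p : R) (x h s t : nat -> R) (x' h' s' t' : R) :
  UltraFilter U -> x n @[n --> U] --> x' -> h n @[n --> U] --> h' ->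
  s n @[n --> U] --> s' -> t n @[n --> U] --> t' ->
  U [set n | rich L (top a b (x n) (h n) (s n) (t n)) p] ->
  rich L (top a b x' h' s' t') p.
Proof.
move=> UU hx hh hs ht rU; apply: (rich_lim UU rU) => q Uq.
have hc z : z @[_ --> U] --> (z : R) by exact: cvg_cst.
have hp : phi (x n) (h n) (s n) (lin a b q) (lin 0 1 q) @[n --> U]
    --> phi x' h' s' (lin a b q) (lin 0 1 q) by exact: cvg_phi.
have hp' : phi (- x n) (h n) (t n) (lin (- a) (- b) q) (lin 0 1 q) @[n --> U]
    --> phi (- x') h' t' (lin (- a) (- b) q) (lin 0 1 q).
  by apply: cvg_phi => //; exact: cvgN.
split.
  by apply: (ultra_le UU (hc _) hp); apply: filterS Uq => n [].
by apply: (ultra_le UU (hc _) hp'); apply: filterS Uq => n [].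
Qed.

(** The limit [u'] of the rich openings is at most [s'] and exceeds -1, where the wedge is a line
    and not rich; monotonicity then carries richness from [u'] to [s']. Default openings force
    [s' = 1], where the wedge contains the halfplane at [x1]. *)
Lemma wedge_side_limit (R : realType) (U : set_system nat)
    (B : {fset set (plane R)}) (a b r x1 x' h' s' : R) (s y g u : nat -> R) :
  UltraFilter U -> nice B -> a != 0 -> {in B, forall l, crosses a b l} ->
  2 < r -> rich B (halfplane a b x1) r -> x1 <= x' ->
  y n @[n --> U] --> x' -> g n @[n --> U] --> h' -> s n @[n --> U] --> s' ->
  s' <= 1 ->
  (forall n, [/\ -1 <= u n, u n <= s n, s n <= 1 &
     u n = 1 \/ rich B (wedge a b (y n) (g n) (u n)) r]) ->
  -1 < s' /\ rich B (wedge a b x' h' s') r.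
Proof.
move=> UU nB a0 cr r2 rB1 x1x' hy hg hs s'1 uP.
have [u' hu] : exists u' : R, u n @[n --> U] --> u'.
  apply: (@ultra_cvg _ _ _ 1) => //; apply: filterE => n.
  have [h1 h2 h3 _] := uP n.
  by rewrite /= ler_norml h1 (le_trans h2).
have hc z : z @[_ --> U] --> (z : R) by exact: cvg_cst.
have u's' : u' <= s'.
  by apply: (ultra_le UU hu hs); apply: filterE => n; have [] := uP n.
have [] := @ultraU _ U [set n | u n = 1]
  [set n | rich B (wedge a b (y n) (g n) (u n)) r] UU.
- by apply: filterE => n; have [] := uP n.
- move=> u1; have u'1 : 1 <= u'.
    by apply: (ultra_le UU (hc 1) hu); apply: filterS u1 => n /= ->.
  have s1 : s' = 1 by apply/eqP; rewrite eq_le s'1 (le_trans u'1).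
  rewrite s1; split; first by lra.
  apply: richS rB1; last exact: lexx.
  move=> q _ hq; apply: halfplane_wedge; rewrite ?ler01 //; first by left.
  exact: le_trans hq _.
- move=> /(wedge_lim UU hy hg hu) rw.
  have u'1 : -1 <= u'.
    by apply: (ultra_le UU (hc _) hu); apply: filterE => n; have [] := uP n.
  have u'1' : -1 < u'.
    rewrite lt_neqAle u'1 andbT; apply/eqP => e.
    apply: (@line_not_rich _ B a b x' r nB a0 cr r2).
    apply: richS rw; last exact: lexx.
    move=> q _ [qx]; rewrite -e /phi normrN1 subrr mul0r addr0 mulN1r oppr_le0.
    by rewrite subr_ge0 => xq; apply/eqP; rewrite eq_le qx.
  split; first exact: lt_le_trans u's'.
  by apply: richS rw; [move=> q _; exact: wedge_mono|exact: lexx].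
Qed.

Lemma rich_of_not_separated (R : realType) (A B : {fset set (plane R)})
    (a b c p p' r : R) :
  nice A -> a != 0 \/ b != 0 -> 0 < p -> p * p' <= #|` A|%:R - 1 ->
  ~ separated B A r p' a b -> rich B (halfplane a b c) r ->
  rich A (halfplane a b c) p.
Proof.
move=> nA ab p0 pp' nsep rB.
by have [//|rA] := halfplane_cover c nA ab p0 pp'; case: nsep; exists c.
Qed.

Section FanLimit.
Context (R : realType) (A B : {fset set (plane R)}).
Context (a b p1 p2 p3 p1' p3' r1 r2 r3 x1 x2 d : R).
Hypotheses (nA : nice A) (nB : nice B) (a0 : a != 0).
Hypotheses (crB : {in B, forall l, crosses a b l}).
Hypotheses (p10 : 0 < p1) (p30 : 0 < p3).
Hypotheses (r12 : 2 < r1) (r22 : 2 < r2) (r31 : 1 < r3).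
Hypotheses (pp1 : p1 * p1' <= #|` A|%:R - 1) (pp3 : p3 * p3' <= #|` A|%:R - 1).
Hypotheses (sep1 : forall u v, u != 0 \/ v != 0 -> ~ separated B A r1 p1' u v).
Hypotheses (sep3 : forall u v, u != 0 \/ v != 0 -> ~ separated B A r3 p3' u v).
Hypotheses (B1 : rich B (halfplane a b x1) r1).
Hypotheses (B2 : rich B (halfplane (- a) (- b) (- x2)) r2).

(** With the apex at minus infinity the wedge is empty for [s <= 0] and a halfplane for [s > 0].
    This serves the bottom row, coloured [Left] without regard to [A]. *)
Lemma rich_bottom_wedge (x h s : R) : -1 < s -> s <= 1 -> h = -1 ->
  rich B (wedge a b x h s) r1 -> rich A (wedge a b x h s) p1.
Proof.
move=> s1 s1' -> rB.
have [q _ [qx]] := rich_point nB (lt_trans (ltr1n R 2) r12) rB.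
rewrite /phi normrN1 subrr mul0r add0r opprK mulr1 => hq.
have s0 : 0 < s.
  rewrite ltNge; apply/negP => s0; move: hq; rewrite (ler0_norm s0).
  have : 0 <= s * (lin a b q - x) by rewrite mulr_le0 // subr_le0.
  by lra.
have sab : s * a != 0 \/ s * b != 0 by left; rewrite mulf_neq0 // gt_eqF.
have linE z : lin (s * a) (s * b) z = s * lin a b z by rewrite /lin; ring.
have rBh : rich B (halfplane (s * a) (s * b) (s * x - (1 - s))) r1.
  apply: richS rB; last exact: lexx.
  move=> z _ [_]; rewrite /phi normrN1 subrr mul0r add0r opprK mulr1.
  by rewrite (gtr0_norm s0) /halfplane /= linE; lra.
apply: richS (rich_of_not_separated nA sab p10 pp1 (sep1 sab) rBh); last exact: lexx.
move=> z _; rewrite /halfplane /= linE => hz.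
split; last by rewrite /phi normrN1 subrr mul0r add0r opprK mulr1 (gtr0_norm s0); lra.
by rewrite -(ler_pM2l s0); lra.
Qed.

(** The two upper rays form a line, so the top is a halfplane. If the gradient vanishes, [phi] is
    the constant [- h], and wedge and top are both nonempty only for [h = 0], against [|h| = 1]. *)
Lemma rich_flat_top (x h s : R) : -1 <= s <= 1 -> `|h| <= 1 ->
  rich B (wedge a b x h s) r1 -> rich B (top a b x h s (- s)) r3 ->
  rich A (top a b x h s (- s)) p3.
Proof.
move=> s1 h1 rw rt.
pose u := s * a; pose v := s * b + (1 - `|s|) * (1 - `|h|).
have phiE q : phi x h s (lin a b q) (lin 0 1 q) =
    lin u v q - (s * x + (1 - `|s|) * h) by rewrite /phi /lin /u /v; ring.
have phiN q : phi (- x) h (- s) (lin (- a) (- b) q) (lin 0 1 q) =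
    phi x h s (lin a b q) (lin 0 1 q) by rewrite /phi normrN linN; ring.
have topE q : top a b x h s (- s) q <->
    halfplane (- u) (- v) (- (s * x + (1 - `|s|) * h)) q.
  rewrite /top /= phiN phiE /halfplane /= linN lerN2 subr_ge0.
  by split=> [[]|].
have [uv|uv] := pselect (u != 0 \/ v != 0).
  have nuv : - u != 0 \/ - v != 0 by rewrite !oppr_eq0.
  have rBh : rich B (halfplane (- u) (- v) (- (s * x + (1 - `|s|) * h))) r3.
    by apply: richS rt; [move=> q _ /topE|exact: lexx].
  apply: richS (rich_of_not_separated nA nuv p30 pp3 (sep3 nuv) rBh);
    last exact: lexx.
  by move=> q _ /topE.
have u0 : u = 0 by apply/eqP; apply: contrapT => /negP; tauto.
have v0 : v = 0 by apply/eqP; apply: contrapT => /negP; tauto.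
have s0 : s = 0 by apply/eqP; move/eqP: u0; rewrite mulf_eq0 (negbTE a0) orbF.
have h2 : `|h| = 1 by move: v0; rewrite /v s0 normr0 mul0r; lra.
have phi0 q : phi x h s (lin a b q) (lin 0 1 q) = - h.
  by rewrite /phi s0 h2 normr0 mul0r subrr subr0 mul0r mul1r !add0r.
have [q _ [_]] := rich_point nB (lt_trans (ltr1n R 2) r12) rw.
have [q' _ [+ _]] := rich_point nB r31 rt.
rewrite !phi0 => h3 h4.
have h0 : h = 0 by lra.
by move: h2; rewrite h0 normr0 => /eqP; rewrite eq_sym oner_eq0.
Qed.

Lemma fan_limit :
  (exists2 e : R ^nat, (e n @[n --> \oo] --> 0) &
   exists2 e' : R ^nat, (e' n @[n --> \oo] --> 0) &
   forall n, exists x h s t,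
     fan_approx A B a b x1 x2 d p1 p2 p3 r1 r2 r3 (e n) (e' n) x h s t) ->
  exists x h s t, [/\ `|h| <= 1, -1 <= s <= 1, -1 <= t <= 1 & 0 <= s + t] /\
   [/\ rich A (wedge a b x h s) p1, rich A (wedge (- a) (- b) (- x) h t) p2
     & rich A (top a b x h s t) p3] /\
   [/\ rich B (wedge a b x h s) r1, rich B (wedge (- a) (- b) (- x) h t) r2
     & rich B (top a b x h s t) r3].
Proof.
move=> [e e0 [e' e'0 /choice[x /choice[h /choice[s /choice[t fan]]]]]].
have [U [UU oU]] := ultra_exists.
have {}e0 : e n @[n --> U] --> (0 : R) by apply: cvg_trans e0 => D; exact: oU.
have {}e'0 : e' n @[n --> U] --> (0 : R) by apply: cvg_trans e'0 => D; exact: oU.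
have hc z : z @[_ --> U] --> (z : R) by exact: cvg_cst.
have UF : Filter U by typeclasses eauto.
have near (u v : nat -> R) (l : R) : (forall n, `|v n - u n| <= e n) ->
    u n @[n --> U] --> l -> v n @[n --> U] --> l.
  move=> vu hu; apply/cvgrPdist_lt => eps eps0.
  have eps2 : 0 < eps / 2 by rewrite divr_gt0.
  have Uu : U [set n | `|l - u n| < eps / 2] by move/cvgrPdist_lt: hu; exact.
  have Ue : U [set n | e n < eps / 2] by exact: (cvgr_lt _ e0).
  apply: filterS2 Uu Ue => n /= h1 h2.
  have -> : l - v n = (l - u n) - (v n - u n) by ring.
  rewrite (le_lt_trans (ler_normB _ _)) // (splitr eps) ltr_leD //.
  by rewrite (le_trans (vu n)) // ltW.
have [x' hx] : exists x' : R, x n Right @[n --> U] --> x'.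
  apply: (@ultra_cvg _ _ _ (`|x1| + `|x2| + `|d|)) => //; apply: filterE => n /=.
  have [/(_ Right)[/andP[h1 h2] _ _ _] _ _ _ _] := fan n.
  have := ler_norm x2; have := ler_norm d; have := ler_norm (- x1).
  have := ler_norm (- d); have := ler_norm (- x2); have := ler_norm x1.
  by rewrite !normrN ler_norml => *; apply/andP; split; lra.
have [h' hh] : exists h' : R, h n Right @[n --> U] --> h'.
  apply: (@ultra_cvg _ _ _ 1) => //; apply: filterE => n /=.
  by have [/(_ Right)[]] := fan n.
have [s' hs] : exists s' : R, s n Right @[n --> U] --> s'.
  apply: (@ultra_cvg _ _ _ 1) => //; apply: filterE => n /=.
  by have [/(_ Right)[_ _ h3 _]] := fan n; rewrite ler_norml.
have [t' ht] : exists t' : R, t n Right @[n --> U] --> t'.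
  apply: (@ultra_cvg _ _ _ 1) => //; apply: filterE => n /=.
  by have [/(_ Right)[_ _ _ h3]] := fan n; rewrite ler_norml.
(* The fans of the three colours have common limits. *)
have hxk k : x n k @[n --> U] --> x'.
  by apply: near hx => n; have [_ /(_ k Right)[]] := fan n.
have hhk k : h n k @[n --> U] --> h'.
  by apply: near hh => n; have [_ /(_ k Right)[]] := fan n.
have hsk k : s n k @[n --> U] --> s'.
  by apply: near hs => n; have [_ /(_ k Right)[]] := fan n.
have htk k : t n k @[n --> U] --> t'.
  by apply: near ht => n; have [_ /(_ k Right)[]] := fan n.
have h'1 : `|h'| <= 1.
  have c : `|h n Right| @[n --> U] --> `|h'| by exact: cvg_norm.
  apply: (ultra_le UU c (hc 1)); apply: filterE => n /=.
  by have [/(_ Right)[]] := fan n.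
have s'1 : -1 <= s' <= 1.
  apply/andP; split; [apply: (ultra_le UU (hc _) hs)|apply: (ultra_le UU hs (hc _))];
    by apply: filterE => n /=; have [/(_ Right)[_ _ /andP[]]] := fan n.
have t'1 : -1 <= t' <= 1.
  apply/andP; split; [apply: (ultra_le UU (hc _) ht)|apply: (ultra_le UU ht (hc _))];
    by apply: filterE => n /=; have [/(_ Right)[_ _ _ /andP[]]] := fan n.
have x1x' : x1 <= x'.
  have c : x1 - e n @[n --> U] --> x1.
    by rewrite -[X in _ --> X]subr0; exact: cvgB.
  by apply: (ultra_le UU c (hxk Up)); apply: filterE => n /=; have [_ _ _ _ []] := fan n.
have x'x2 : x' <= x2.
  have c : x2 + e n @[n --> U] --> x2.
    by rewrite -[X in _ --> X]addr0; exact: cvgD.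
  by apply: (ultra_le UU (hxk Up) c); apply: filterE => n /=; have [_ _ _ _ []] := fan n.
have st0 : 0 <= s' + t'.
  have c : s n Right + t n Right @[n --> U] --> s' + t' by exact: cvgD.
  apply: (ultra_le UU (hc 0) c); apply: filterE => n /=.
  by have [_ _ _ _ [_ _ _ []]] := fan n.
have /choice[y /choice[g /choice[u uP]]] := fun n => let: And5 _ _ k _ _ := fan n in k.
have /choice[y2 /choice[g2 /choice[u2 u2P]]] := fun n => let: And5 _ _ _ k _ := fan n in k.
have [s'gt rBs] : -1 < s' /\ rich B (wedge a b x' h' s') r1.
  apply: (@wedge_side_limit _ U B a b r1 x1 x' h' s' (fun n => s n Right) y g u) => //.
  - by apply: near hx => n; have [] := uP n.
  - by apply: near hh => n; have [] := uP n.
  - by case/andP: s'1.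
  - move=> n; have [_ _ h3 h4 h5] := uP n; split=> //.
    by have [/(_ Right)[_ _ /andP[]]] := fan n.
have [t'gt rBt] : -1 < t' /\ rich B (wedge (- a) (- b) (- x') h' t') r2.
  apply: (@wedge_side_limit _ U B (- a) (- b) r2 (- x2) (- x') h' t'
    (fun n => t n Right) (fun n => - y2 n) g2 u2) => //.
  - by rewrite oppr_eq0.
  - by move=> l /crB /crossesN.
  - by rewrite lerN2.
  - by apply: cvgN; apply: near hx => n; have [] := u2P n.
  - by apply: near hh => n; have [] := u2P n.
  - by case/andP: t'1.
  - move=> n; have [_ _ h3 h4 h5] := u2P n; split=> //.
    by have [/(_ Right)[_ _ _ /andP[]]] := fan n.
have rBtop : rich B (top a b x' h' s' t') r3.
  (* As [s'] and [t'] exceed -1, the proviso on the lowered openings holds for [U]-many [n]. *)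
  have ev (w : nat -> R) (w' : R) : -1 < w' -> w n @[n --> U] --> w' ->
      U [set n | -1 + e n <= w n].
    move=> w'1 hw; have c : w n - e n @[n --> U] --> w'.
      by rewrite -[w']subr0; exact: cvgB.
    have : U [set n | -1 < w n - e n] by exact: (cvgr_gt _ c).
    by apply: filterS => n /=; rewrite ltrBrDr => /ltW.
  apply: (top_lim UU hx hh (s := fun n => s n Right - e' n)
    (t := fun n => t n Right - e' n)).
  - by rewrite -[s']subr0; exact: cvgB.
  - by rewrite -[t']subr0; exact: cvgB.
  - apply: filterS2 (ev _ _ s'gt hs) (ev _ _ t'gt ht) => n /= h1 h2.
    by have [_ _ _ _ [_ _ _ [_ _ k] _]] := fan n; exact: k.
have rA2 : rich A (wedge (- a) (- b) (- x') h' t') p2.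
  apply: (wedge_lim UU (cvgN hx) hh ht); apply: filterE => n /=.
  by have [_ _ _ _ [_ _ _ []]] := fan n.
have rA1 : rich A (wedge a b x' h' s') p1.
  have [] := @ultraU _ U [set n | h n Left <= -1 + e n]
    [set n | rich A (wedge a b (x n Left) (h n Left) (s n Left)) p1] UU.
  - by apply: filterE => n; have [_ _ _ _ []] := fan n.
  - move=> Uh; have c : -1 + e n @[n --> U] --> (-1 : R).
      by rewrite -[X in _ --> X]addr0; exact: cvgD.
    have h2 := ultra_le UU (hhk Left) c Uh.
    apply: rich_bottom_wedge => //; first by case/andP: s'1.
    by apply/eqP; rewrite eq_le h2 /= lerNl (le_trans _ h'1) // -normrN ler_norm.
  - exact: (wedge_lim UU (hxk Left) (hhk Left) (hsk Left)).
have rA3 : rich A (top a b x' h' s' t') p3.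
  have [] := @ultraU _ U [set n | s n Up + t n Up <= e' n]
    [set n | rich A (top a b (x n Up) (h n Up) (s n Up) (t n Up)) p3] UU.
  - by apply: filterE => n; have [_ _ _ _ []] := fan n.
  - move=> Ust; have c : s n Up + t n Up @[n --> U] --> s' + t' by exact: cvgD.
    have h2 := ultra_le UU c e'0 Ust.
    have tE : t' = - s' by lra.
    rewrite tE; apply: rich_flat_top => //; by rewrite -tE.
  - exact: (top_lim UU (hxk Up) (hhk Up) (hsk Up) (htk Up)).
by exists x', h', s', t'.
Qed.

End FanLimit.

(** * Closedness, convexity and disjoint interiors of the parts *)

Lemma halfplane_closed (R : realType) (a b c : R) : closed (halfplane a b c).
Proof.
have cont : continuous (fun q : plane R => a * q 0 0 + b * q 0 1).
  move=> q; have hc (i : 'I_2) (k : R) :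
      k * (x : plane R) 0 i @[x --> q] --> k * q 0 i.
    apply: cvgMl_tmp; last exact: (@coord_continuous R 1 2 0 i q).
    exact: (nbhs_filter q).
  by apply: (cvgD (hc 0 a) (hc 1 b)); exact: (nbhs_filter q).
have -> : halfplane a b c = lin a b @^-1` [set z | z <= c] by [].
by apply: closed_comp; [move=> q _; exact: cont|exact: closed_le].
Qed.

Lemma halfplane_convex (R : realType) (a b c : R) :
  convex_set (halfplane a b c).
Proof.
move=> q q' l; rewrite !inE /halfplane /= => hq hq'.
set z := (X in lin a b X <= c).
have -> : z = l%:num *: q + (1 - l%:num) *: q' by [].
rewrite linD !linZ.
have l0 : 0 <= l%:num by [].
have l1 : 0 <= 1 - l%:num by rewrite subr_ge0.
have := ler_wpM2l l0 hq; have := ler_wpM2l l1 hq'; lra.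
Qed.

Lemma convex_setI (R : realType) (C D : set (plane R)) :
  convex_set C -> convex_set D -> convex_set (C `&` D)%classic.
Proof.
move=> hC hD x y l; rewrite !inE => -[Cx Dx] [Cy Dy].
by split; apply/set_mem; [apply: hC|apply: hD]; rewrite inE.
Qed.

Lemma phi_lin (R : realType) (a b x h s : R) (q : plane R) :
  phi x h s (lin a b q) (lin 0 1 q) =
  lin (s * a) (s * b + (1 - `|s|) * (1 - `|h|)) q - (s * x + (1 - `|s|) * h).
Proof. by rewrite /phi /lin; ring. Qed.

Lemma wedge_setI (R : realType) (a b x h s : R) :
  wedge a b x h s = (halfplane a b x `&`
    halfplane (s * a) (s * b + (1 - `|s|) * (1 - `|h|)) (s * x + (1 - `|s|) * h))%classic.
Proof. by apply/seteqP; split=> q []; rewrite /wedge /halfplane /= phi_lin subr_le0. Qed.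

Lemma top_setI (R : realType) (a b x h s t : R) :
  top a b x h s t = (halfplane (- (s * a)) (- (s * b + (1 - `|s|) * (1 - `|h|)))
     (- (s * x + (1 - `|s|) * h)) `&`
    halfplane (- (t * - a)) (- (t * - b + (1 - `|t|) * (1 - `|h|)))
     (- (t * - x + (1 - `|t|) * h)))%classic.
Proof.
by apply/seteqP; split=> q []; rewrite /top /halfplane /= !phi_lin !(linN _ _ q) !lerN2 !subr_ge0.
Qed.

(** A common interior point could be moved off the line along [(u, v)]. With zero gradient and
    [c != 0] there is no common point at all. *)
Lemma line_interior (R : realType) (u v c : R) (C D : set (plane R)) :
  [\/ u != 0, v != 0 | c != 0] ->
  (forall q, C q -> D q -> lin u v q = c) -> (C° `&` D° = set0)%classic.
Proof.
move=> uvc CD; apply/seteqP; split=> // q [Cq Dq].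
have [uv0|uv0] := eqVneq (u * u + v * v) 0.
  have [u0 v0] : u = 0 /\ v = 0.
    move/eqP: uv0; rewrite -!expr2 paddr_eq0 ?sqr_ge0 // !sqrf_eq0.
    by move=> /andP[/eqP-> /eqP->].
  have := CD q (interior_subset Cq) (interior_subset Dq).
  rewrite u0 v0 /lin !mul0r addr0 => c0.
  by case: uvc; rewrite ?u0 ?v0 -?c0 eqxx.
have /nbhs_ballP[e /= e0 eCD] : nbhs q (C `&` D)%classic by exact: filterI.
pose w : plane R := \row_j if j == 0 then u else v.
have lw : lin u v w = u * u + v * v by rewrite /lin !mxE.
pose k := e / 2 / (`|w| + 1).
have w1 : 0 < `|w| + 1 by rewrite ltr_wpDl.
have k0 : 0 < k by rewrite !divr_gt0.
have [] := eCD (q + k *: w).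
  rewrite -ball_normE /ball_ /= opprD addrA subrr add0r normrN normrZ gtr0_norm //.
  rewrite /k mulrAC ltr_pdivrMr //.
  have := mulr_gt0 e0 w1; have := mulr_ge0 (ltW e0) (normr_ge0 w); lra.
move=> Cw Dw; have := CD _ Cw Dw.
rewrite linD linZ lw (CD q (interior_subset Cq) (interior_subset Dq)).
move/eqP; rewrite -[X in _ == X]addr0 (inj_eq (addrI c)) mulf_eq0 (negbTE uv0) orbF.
by rewrite gt_eqF.
Qed.

Lemma phi_gradient (R : realType) (a b x h s : R) :
  a != 0 -> [\/ s * a != 0, s * b + (1 - `|s|) * (1 - `|h|) != 0
    | s * x + (1 - `|s|) * h != 0].
Proof.
move=> a0; have [s0|s0] := eqVneq s 0; last by constructor 1; rewrite mulf_neq0.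
rewrite s0 normr0 !mul0r !add0r subr0 !mul1r.
have [h0|h0] := eqVneq h 0; last by constructor 3.
by constructor 2; rewrite h0 normr0 subr0 oner_neq0.
Qed.

Lemma fan_interiors (R : realType) (a b x h s t : R) :
  a != 0 ->
  [/\ ((wedge a b x h s)° `&` (wedge (- a) (- b) (- x) h t)° = set0)%classic,
      ((wedge a b x h s)° `&` (top a b x h s t)° = set0)%classic
    & ((wedge (- a) (- b) (- x) h t)° `&` (top a b x h s t)° = set0)%classic].
Proof.
move=> a0; split.
- apply: (@line_interior _ a b x); first by constructor 1.
  by move=> q [h1 _] [+ _]; rewrite linN lerN2 => h2; apply/eqP; rewrite eq_le h1.
- apply: (line_interior (@phi_gradient _ a b x h s a0)).
  move=> q [_ h1] [h2 _]; apply/eqP.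
  by rewrite -subr_eq0 -phi_lin eq_le h1.
- have na0 : - a != 0 by rewrite oppr_eq0.
  apply: (line_interior (@phi_gradient _ (- a) (- b) (- x) h t na0)).
  move=> q [_ h1] [_ h2]; apply/eqP.
  by rewrite -subr_eq0 -phi_lin eq_le h1.
Qed.

(** Each line excludes at most one [k], so any [k] beyond all these values will do. *)
Lemma crossing_direction (R : realType) (L : {fset set (plane R)}) :
  line_set L -> exists k : R, {in L, forall l, crosses 1 k l}.
Proof.
move=> hL; have /choice[g gP] : forall l : set (plane R), exists g : R,
    l \in L -> forall k, g < k -> crosses 1 k l.
  move=> l; case: (boolP (l \in L)) => [/hL[p [v [v0 lE]]]|_]; last by exists 0.
  have [v1|v1] := eqVneq (v 0 1) 0.
    exists 0 => _ k _; exists p, v; split=> //; rewrite /lin v1 mul1r mulr0 addr0.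
    apply: contra v0 => /eqP v00; apply/eqP.
    have det : 1 * 1 - 0 * 0 != 0 :> R by rewrite mul0r subr0 mulr1 oner_neq0.
    by apply: (frame_inj det); rewrite /lin !mxE v1 v00.
  exists (- v 0 0 / v 0 1) => _ k kg; exists p, v; split=> //.
  apply/eqP; rewrite /lin mul1r => e; move: kg.
  have -> : k = - v 0 0 / v 0 1.
    by apply: (canRL (mulfK v1)); apply/eqP; rewrite -addr_eq0 addrC e.
  by rewrite ltxx.
exists (1 + \sum_(l <- L) `|g l|) => l lL; apply: gP => //.
rewrite (le_lt_trans (ler_norm _)) // (big_rem l) //=.
have : 0 <= \sum_(m <- rem l L) `|g m| by apply: sumr_ge0.
lra.
Qed.

(** * The choice of the cut *)

(** The vertical ray is sought between [x1], where the left side becomes rich in [B], and [x2],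
    where the right side ceases to be; [r2 <= r1'] gives [x1 <= x2]. The absence of separations
    leaves a margin [d] outside of which the halfplanes are still rich in [A]. *)
Lemma three_cut (R : realType) (A B : {fset set (plane R)})
    (p1 p2 p3 p1' p2' p3' r1 r2 r3 r1' r2' : R) :
  nice A -> nice B -> 0 < p1 -> 0 < p2 -> 0 < p3 ->
  p1 * p1' <= #|` A|%:R - 1 -> p2 * p2' <= #|` A|%:R - 1 ->
  p3 * p3' <= #|` A|%:R - 1 -> p1 * p2 * p3 <= #|` A|%:R / 2 ->
  2 < r1 -> 2 < r2 -> 1 < r3 -> 1 < r1' -> 1 < r2' -> r2 <= r1' ->
  r1 * r1' <= #|` B|%:R - 1 -> r2 * r2' <= #|` B|%:R - 1 ->
  r1 * r2 * r3 <= #|` B|%:R / 2 ->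
  (forall u v, u != 0 \/ v != 0 -> ~ separated B A r1 p1' u v) ->
  (forall u v, u != 0 \/ v != 0 -> ~ separated B A r2 p2' u v) ->
  (forall u v, u != 0 \/ v != 0 -> ~ separated B A r3 p3' u v) ->
  exists x h s t k, [/\ -1 <= s <= 1, -1 <= t <= 1 & 0 <= s + t] /\
   [/\ rich A (wedge 1 k x h s) p1, rich A (wedge (- 1) (- k) (- x) h t) p2
     & rich A (top 1 k x h s t) p3] /\
   [/\ rich B (wedge 1 k x h s) r1, rich B (wedge (- 1) (- k) (- x) h t) r2
     & rich B (top 1 k x h s t) r3].
Proof.
move=> nA nB p10 p20 p30 pp1 pp2 pp3 ppp r12 r22 r31 r1'1 r2'1 r21 rr1 rr2 rrr
  sep1 sep2 sep3.
have hAB : line_set (A `|` B).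
  by move=> l; rewrite inE => /orP[]; [case: nA => h _ _|case: nB => h _ _]; exact: h.
have [k cr] := crossing_direction hAB.
have crA : {in A, forall l, crosses 1 k l}.
  by move=> l lA; apply: cr; rewrite inE lA.
have crB : {in B, forall l, crosses 1 k l}.
  by move=> l lB; apply: cr; rewrite inE lB orbT.
have k0 : (1 : R) != 0 \/ k != 0 by left; exact: oner_neq0.
have nk0 : (- 1 : R) != 0 \/ - k != 0 by left; rewrite oppr_eq0 oner_neq0.
have r11 : 1 < r1 by rewrite (lt_trans _ r12) // ltr1n.
have r21' : 1 < r2 by rewrite (lt_trans _ r22) // ltr1n.
have [x1 [B1 B1' B1min]] := least_halfplane nB k0 r11 r1'1 rr1.
have [x2' [B2 _ B2min]] := least_halfplane nB nk0 r21' r2'1 rr2.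
pose x2 := - x2'.
have x2E : x2' = - x2 by rewrite /x2 opprK.
rewrite x2E in B2 B2min.
have x12 : x1 <= x2.
  by rewrite -lerN2; apply: B2min; apply: richS B1'.
have [d1 d10 A1] := halfplane_lim_left nA k0 p10 pp1 B1 (sep1 _ _ k0).
have [d2 d20 A2] := halfplane_lim_left nA nk0 p20 pp2 B2 (sep2 _ _ nk0).
pose d := Num.min d1 d2.
have d0 : 0 < d by rewrite lt_min d10.
have dA1 : rich A (halfplane 1 k (x1 - d)) p1.
  apply: richS A1; last exact: lexx.
  by move=> q _ /le_trans; apply; rewrite lerD2l lerN2 ge_min lexx.
have dA2 : rich A (halfplane (- 1) (- k) (- (x2 + d))) p2.
  apply: richS A2; last exact: lexx.
  by move=> q _ /le_trans; apply; rewrite opprD lerD2l lerN2 ge_min lexx orbT.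
have [M [M0 MP]] := intersections_bounded nA.
have [M' [M'0 M'P]] := intersections_bounded nB.
pose w := x2 - x1 + d; pose c := 2 * (d + w) + 4.
have w0 : 0 < w by rewrite ltr_wpDl // subr_ge0.
pose n0 := (Num.bound (2 * w / d) + Num.bound (2 * (M + M')))%N.+1.
have bnd (z : R) : 0 <= z -> z <= (Num.bound z)%:R by move=> /archi_boundP/ltW.
have n0w : 2 * w <= d * n0%:R.
  have wd : 0 <= 2 * w / d by rewrite divr_ge0 ?(ltW d0) // mulr_ge0 // ltW.
  by rewrite [leRHS]mulrC -ler_pdivrMr // (le_trans (bnd _ wd)) // ler_nat /n0; nat_lia.
have n0M : 2 * (M + M') <= n0%:R.
  have MM : 0 <= 2 * (M + M') by rewrite mulr_ge0 // addr_ge0.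
  by rewrite (le_trans (bnd _ MM)) // ler_nat /n0; nat_lia.
have n0n n : n0%:R <= (n + n0).+1%:R :> R by rewrite ler_nat; nat_lia.
have app n := @fan_approximation R A B 1 k x1 x2 d (M + M') p1 p2 p3 r1 r2 r3
  (n + n0).+1 nA nB (oner_neq0 R) crA crB p10 p20 ppp (lt_trans ltr01 r11)
  (lt_trans ltr01 r21') rrr d0 x12 (addr_ge0 M0 M'0).
have MA q : intersection_points A q -> lin 0 1 q <= M + M'.
  move=> /MP[_ h]; rewrite /lin mul0r add0r mul1r.
  by rewrite (le_trans (ler_norm _)) // (le_trans h) // lerDl.
have MB q : intersection_points B q -> lin 0 1 q <= M + M'.
  move=> /M'P[_ h]; rewrite /lin mul0r add0r mul1r.
  by rewrite (le_trans (ler_norm _)) // (le_trans h) // lerDr.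
have {}app n : exists x h s t, fan_approx A B 1 k x1 x2 d p1 p2 p3 r1 r2 r3
    (c / (n + n0).+1%:R) (n + n0).+1%:R^-1 x h s t.
  apply: app => //.
  - by rewrite ltnS addn_gt0 orbT.
  - by apply: le_trans n0w _; rewrite ler_pM2l.
  - exact: le_trans n0M _.
have e'0 : (n + n0).+1%:R^-1 @[n --> \oo] --> (0 : R).
  by have := @cvg_harmonic R; rewrite -(cvg_shiftn n0).
have e0 : c / (n + n0).+1%:R @[n --> \oo] --> (0 : R).
  by rewrite -[X in _ --> X](mulr0 c); apply: cvgMl_tmp.
have [|x [h [s [t [[_ hs ht hst] rich12]]]]] := fan_limit (d := d) (p2 := p2) nA nB
    (oner_neq0 R) crB p10 p30 r12 r22 r31 pp1 pp3 sep1 sep3 B1 B2.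
  exists (fun n => c / (n + n0).+1%:R) => //.
  by exists (fun n => (n + n0).+1%:R^-1).
by exists x, h, s, t, k; split=> //; split=> //; case: rich12.
Qed.

Lemma separatedN (R : realType) (A B : {fset set (plane R)}) (p q u v : R) :
  separated A B p q u v -> separated B A q p (- u) (- v).
Proof. by move=> [c [h1 h2]]; exists (- c); rewrite !opprK. Qed.

Definition balanced (R : realType) (A B : {fset set (plane R)})
    (a b : nat -> R) (k l : nat) : Prop :=
  exists u v c, [/\ u != 0 \/ v != 0, rich A (halfplane u v c) (a k),
    rich A (halfplane (- u) (- v) (- c)) (a l),
    rich B (halfplane u v c) (b k) & rich B (halfplane (- u) (- v) (- c)) (b l)].

Definition fan_balanced (R : realType) (A B : {fset set (plane R)})
    (a b : nat -> R) (k l m : nat) : Prop :=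
  exists x h s t c, [/\ -1 <= s <= 1, -1 <= t <= 1 & 0 <= s + t] /\
   [/\ rich A (wedge 1 c x h s) (a k), rich A (wedge (- 1) (- c) (- x) h t) (a l)
     & rich A (top 1 c x h s t) (a m)] /\
   [/\ rich B (wedge 1 c x h s) (b k), rich B (wedge (- 1) (- c) (- x) h t) (b l)
     & rich B (top 1 c x h s t) (b m)].

Definition thresholds (R : realType) (A : {fset set (plane R)}) (a : nat -> R)
    (r : nat) : Prop :=
  [/\ forall k, (0 < k)%N -> (k < r)%N -> 2 < a k,
      forall k l, (0 < k)%N -> (k <= l)%N -> a k <= a l,
      forall k l, (0 < k)%N -> (0 < l)%N -> (k + l = r)%N ->
        a k * a l <= #|` A|%:R - 1
    & forall k l m, (0 < k)%N -> (0 < l)%N -> (0 < m)%N -> (k + l + m = r)%N ->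
        a k * a l * a m <= #|` A|%:R / 2].

(* The counting argument of Bespamyatnikh, Kirkpatrick and Snoeyink.  Without a
   balanced halfplane every [k] has a sign, saying which of the two families
   reaches its threshold first.  The signs of [k] and [r - k] are opposite, so
   three parts of the same sign add up to [r]. *)
Lemma fan_balanced_of_sign (R : realType) (A B : {fset set (plane R)})
    (a b : nat -> R) (r : nat) :
  nice A -> nice B -> thresholds A a r -> thresholds B b r -> (1 < r)%N ->
  let P k := forall u v, u != 0 \/ v != 0 ->
    ~ separated B A (b k) (a (r - k)%N) u v in
  let Q k := forall u v, u != 0 \/ v != 0 ->
    ~ separated A B (a k) (b (r - k)%N) u v in
  (forall k, (0 < k)%N -> (k < r)%N -> P k \/ Q k) -> P 1%N ->
  exists k l m, [/\ (0 < k)%N, (0 < l)%N, (0 < m)%N, (k + l + m = r)%N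
    & fan_balanced A B a b k l m].
Proof.
move=> nA nB [a2 amono a11 a111] [b2 bmono b11 b111] r1 P Q PQ P1.
have gt1 (z : R) : 2 < z -> 1 < z by apply: lt_trans; rewrite ltr1n.
have gt0 (z : R) : 2 < z -> 0 < z by apply: lt_trans.
have excl k : (0 < k)%N -> (k < r)%N -> P k -> Q k -> False.
  move=> k0 kr Pk Qk.
  have rk0 : (0 < r - k)%N by rewrite subn_gt0.
  have rkr : (r - k < r)%N by nat_lia.
  have krE : (k + (r - k) = r)%N by nat_lia.
  have e0 : (1 : R) != 0 \/ (0 : R) != 0 by left; exact: oner_neq0.
  have [c [c1 c2 _]] := least_halfplane nA e0 (gt1 _ (a2 _ k0 kr))
    (gt1 _ (a2 _ rk0 rkr)) (a11 _ _ k0 rk0 krE).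
  have [h|h] := halfplane_cover c nB e0 (gt0 _ (b2 _ k0 kr)) (b11 _ _ k0 rk0 krE).
    by case: (Pk _ _ e0); exists c.
  by case: (Qk _ _ e0); exists c.
have PtoQ k : (k < r)%N -> P k -> Q (r - k)%N.
  move=> kr Pk u v uv /separatedN; rewrite subKn ?(ltnW kr) //.
  by apply: Pk; rewrite !oppr_eq0.
have QtoP k : (k < r)%N -> Q k -> P (r - k)%N.
  move=> kr Qk u v uv /separatedN; rewrite subKn ?(ltnW kr) //.
  by apply: Qk; rewrite !oppr_eq0.
have nPr : ~ P (r - 1)%N.
  by move=> h; apply: (excl (r - 1)%N) => //; [nat_lia|nat_lia|exact: PtoQ].
have exk : exists k, (0 < k)%N && ~~ `[< P k >].
  by exists (r - 1)%N; apply/andP; split; [nat_lia|apply/asboolP].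
(* At the first sign change [k], the parts 1 and [k - 1] have the sign [P], and so has [r - k],
   opposite to [k]. *)
case: (ex_minnP exk) => k /andP[k0 /asboolP nPk] kmin.
have kr : (k <= r - 1)%N.
  by apply: kmin; apply/andP; split; [nat_lia|apply/asboolP].
have k1 : (1 < k)%N.
  by rewrite ltn_neqAle k0 andbT; apply/eqP => e; apply: nPk; rewrite -e.
have Pk1 : P k.-1.
  apply: contrapT => nP; have h : (0 < k.-1)%N && ~~ `[< P k.-1 >].
    by apply/andP; split; [nat_lia|apply/asboolP].
  have := kmin _ h; nat_lia.
have Prk : P (r - k)%N.
  have kr' : (k < r)%N by nat_lia.
  by apply: QtoP => //; have [] := PQ k k0 kr'.
exists 1%N, k.-1, (r - k)%N; split; try nat_lia.
have [l0 m0 s1] : [/\ (0 < k.-1)%N, (0 < r - k)%N & (1 + k.-1 + (r - k) = r)%N].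
  by split; nat_lia.
apply: (three_cut (p1' := a (r - 1)%N) (p2' := a (r - k.-1)%N)
  (p3' := a (r - (r - k))%N) (r1' := b (r - 1)%N) (r2' := b (r - k.-1)%N)) => //;
  try (by apply: gt0; apply: a2; nat_lia); try (by apply: gt1; apply: b2; nat_lia);
  try (by apply: a11; nat_lia); try (by apply: b11; nat_lia);
  try (by apply: a111; nat_lia); try (by apply: b111; nat_lia);
  try (by apply: b2; nat_lia).
by apply: bmono; nat_lia.
Qed.

Lemma balanced_cut (R : realType) (A B : {fset set (plane R)})
    (a b : nat -> R) (r : nat) :
  nice A -> nice B -> thresholds A a r -> thresholds B b r -> (1 < r)%N ->
  (exists k l, [/\ (0 < k)%N, (0 < l)%N, (k + l = r)%N & balanced A B a b k l]) \/
  (exists k l m, [/\ (0 < k)%N, (0 < l)%N, (0 < m)%N, (k + l + m = r)%N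
    & fan_balanced A B a b k l m]).
Proof.
move=> nA nB ta tb r1.
have [[k [l [k0 l0 kl bal]]]|nbal] := pselect (exists k l, [/\ (0 < k)%N,
    (0 < l)%N, (k + l = r)%N & balanced A B a b k l]).
  by left; exists k, l.
right.
have gt1 (z : R) : 2 < z -> 1 < z by apply: lt_trans; rewrite ltr1n.
pose P k := forall u v, u != 0 \/ v != 0 ->
    ~ separated B A (b k) (a (r - k)%N) u v.
pose Q k := forall u v, u != 0 \/ v != 0 ->
    ~ separated A B (a k) (b (r - k)%N) u v.
have PQ k : (0 < k)%N -> (k < r)%N -> P k \/ Q k.
  move=> k0 kr; apply: contrapT => nPQ; apply: nbal.
  have [[u0 [v0 [uv0 E0]]] [u1 [v1 [uv1 F1]]]] :
      (exists u v, (u != 0 \/ v != 0) /\ separated B A (b k) (a (r - k)%N) u v) /\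
      (exists u v, (u != 0 \/ v != 0) /\ separated A B (a k) (b (r - k)%N) u v).
    split; apply: contrapT => nex; apply: nPQ; [left|right] => u v uv sep;
      by apply: nex; exists u, v.
  exists k, (r - k)%N; have rk0 : (0 < r - k)%N by rewrite subn_gt0.
  have rkr : (r - k < r)%N by nat_lia.
  have krE : (k + (r - k) = r)%N by nat_lia.
  split=> //; have [a2 _ a11 _] := ta; have [b2 _ b11 _] := tb.
  exact: (balanced_halfplane nA nB (gt1 _ (a2 _ k0 kr)) (gt1 _ (a2 _ rk0 rkr))
    (gt1 _ (b2 _ k0 kr)) (gt1 _ (b2 _ rk0 rkr)) (a11 _ _ k0 rk0 krE)
    (b11 _ _ k0 rk0 krE) uv0 uv1 E0 F1).
have [P1|Q1] := PQ 1%N isT r1; first exact: fan_balanced_of_sign PQ P1.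
have QP k : (0 < k)%N -> (k < r)%N -> Q k \/ P k.
  by move=> k0 kr; have [] := PQ k k0 kr; [right|left].
have [k [l [m [k0 l0 m0 klm [x [h [s [t [c [h1 [h2 h3]]]]]]]]]]] :=
  fan_balanced_of_sign nB nA tb ta r1 QP Q1.
by exists k, l, m; split=> //; exists x, h, s, t, c.
Qed.

(** * The thresholds *)

(** From [ln (1 + x) <= x] at [x = - 1 / 3]. The value 1/3 is why the estimates below are made for
    cubes. *)
Lemma oppr_ln23_ge (R : realType) : 1 / 3 <= - ln (2 / 3 : R).
Proof.
have := @le_ln1Dx R (- (1 / 3)); rewrite (_ : 1 + - (1 / 3) = 2 / 3); last by field.
by move=> h; have {}h := h _; rewrite lerNr h //; lra.
Qed.

Lemma powR_cube_le (R : realType) (x : R) :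
  0 < x -> x <= 1 -> (x `^ (- ln (2 / 3))) ^+ 3 <= x.
Proof.
move=> x0 x1; rewrite -powR_mulrn ?powR_ge0 // -powRrM ge1r_powR ?x0 //.
have := oppr_ln23_ge R; lra.
Qed.

Lemma bernoulli_ineq (R : realFieldType) (y : R) (n : nat) :
  0 <= y -> 1 + n%:R * y <= (1 + y) ^+ n.
Proof.
move=> y0; elim: n => [|n IH]; first by rewrite mul0r addr0 expr0.
rewrite exprS -natr1 (le_trans _ (ler_wpM2l _ IH)) //; last by rewrite addr_ge0.
have := mulr_ge0 (mulr_ge0 (ler0n R n) y0) y0; lra.
Qed.

(** Bernoulli's inequality for [(r / k) ^ k = (1 + (r - k) / k) ^ k]. *)
Lemma share_le (R : realType) (r k : nat) :
  (0 < k)%N -> (k <= r)%N -> (k%:R / r%:R : R) ^+ k <= (r - k).+1%:R^-1.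
Proof.
move=> k0 kr; have r0 : (0 < r)%N by exact: leq_trans kr.
have k0' : 0 < k%:R :> R by rewrite ltr0n.
have r0' : 0 < r%:R :> R by rewrite ltr0n.
have y0 : 0 <= (r - k)%:R / k%:R :> R by rewrite divr_ge0.
have := bernoulli_ineq k y0.
have -> : 1 + (r - k)%:R / k%:R = (k%:R / r%:R)^-1 :> R.
  by rewrite natrB //; field; rewrite !gt_eqF.
rewrite mulrCA divff ?gt_eqF // mulr1 nat1r exprVn => h.
by rewrite -[leLHS]invrK lef_pV2 // posrE ?invr_gt0 ?exprn_gt0 // divr_gt0.
Qed.

(* The value of [a] for which [k `^ ln (2 / 3) * a `^ k^-1] equals
   [r `^ ln (2 / 3) * m `^ r^-1], so that the recursion loses nothing. *)
Definition threshold (R : realType) (m r k : nat) : R :=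
  (m%:R `^ r%:R^-1 * (k%:R / r%:R) `^ (- ln (2 / 3))) ^+ k.

Lemma rootn_exp (R : realType) (m r : nat) :
  (0 < r)%N -> (m%:R `^ r%:R^-1) ^+ r = m%:R :> R.
Proof.
move=> r0; rewrite -powR_mulrn ?powR_ge0 // -powRrM mulVf ?powRr1 //.
by rewrite pnatr_eq0 -lt0n.
Qed.

Lemma share_cube_le (R : realType) (r k : nat) :
  (0 < k)%N -> (k <= r)%N ->
  (((k%:R / r%:R : R) `^ (- ln (2 / 3))) ^+ k) ^+ 3 <= (r - k).+1%:R^-1.
Proof.
move=> k0 kr; have r0 : (0 < r)%N by exact: leq_trans kr.
have kr0 : 0 < k%:R / r%:R :> R by rewrite divr_gt0 // ltr0n.
rewrite (le_trans _ (share_le R k0 kr)) //.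
rewrite -(powR_mulrn k) ?powR_ge0 // powRAC powR_mulrn ?(ltW kr0) //.
apply: powR_cube_le; first exact: exprn_gt0.
by rewrite exprn_ile1 ?(ltW kr0) // ler_pdivrMr ?ltr0n // mul1r ler_nat.
Qed.

Lemma threshold_base (R : realType) (m r k : nat) : (0 < r)%N ->
  m%:R `^ r%:R^-1 * (k%:R / r%:R) `^ (- ln (2 / 3)) =
  (r%:R `^ ln (2 / 3) * m%:R `^ r%:R^-1) * k%:R `^ (- ln (2 / 3)) :> R.
Proof.
move=> r0; rewrite powRM ?invr_ge0 // -(powR_inv1 (ler0n R r)) -powRrM mulN1r opprK.
by ring.
Qed.

Lemma natr_powR_ge1 (R : realType) (k : nat) :
  (0 < k)%N -> 1 <= k%:R `^ (- ln (2 / 3)) :> R.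
Proof.
move=> k0; rewrite -[leLHS](powRr0 k%:R) ler_powR ?ler1n //.
by have := oppr_ln23_ge R; lra.
Qed.

(** Positivity of the bound means [beta > 2 r >= 4], which makes all thresholds large and gives
    [4 <= n]. A product of thresholds with parts adding up to [r] is [n] times the product of the
    [u k]. *)
Lemma thresholds_threshold (R : realType) (A : {fset set (plane R)}) (r : nat) :
  (1 < r)%N ->
  0 < r%:R `^ ln (2 / 3) * (#|` A|%:R `^ (r%:R^-1)) - 2 * r%:R :> R ->
  thresholds A (threshold R #|` A| r) r.
Proof.
move=> r1; rewrite subr_gt0; set n := #|` A|; set beta := _ `^ ln (2 / 3) * _ => hb.
have r0 : (0 < r)%N by exact: ltnW.
have b4 : 4 < beta.
  apply: (le_lt_trans _ hb); rewrite -natrM (ler_nat R 4); nat_lia.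
have tE k : threshold R n r k = (beta * k%:R `^ (- ln (2 / 3))) ^+ k.
  by rewrite /threshold threshold_base.
have bk k : (0 < k)%N -> 4 < beta * k%:R `^ (- ln (2 / 3)).
  move=> k0; apply: (lt_le_trans b4); rewrite ler_peMr ?natr_powR_ge1 //.
  by rewrite (le_trans _ (ltW b4)).
have n4 : 4 <= n%:R :> R.
  rewrite -(rootn_exp R n r0).
  have : beta <= n%:R `^ r%:R^-1.
    rewrite /beta ler_piMl ?powR_ge0 // -(opprK (ln _)) powRN invf_le1.
      exact: natr_powR_ge1.
    by rewrite powR_gt0 // ltr0n.
  move=> h; have {}h : 4 <= n%:R `^ r%:R^-1 :> R by rewrite (le_trans _ h) // ltW.
  rewrite (le_trans h) // ler_eXnr //; by rewrite (le_trans _ h) // ler1n.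
pose u k : R := ((k%:R / r%:R) `^ (- ln (2 / 3))) ^+ k.
have u0 k : 0 <= u k by rewrite exprn_ge0 // powR_ge0.
have tu k : threshold R n r k = (n%:R `^ r%:R^-1) ^+ k * u k.
  by rewrite /threshold exprMn.
have u3 k c : (0 < k)%N -> (k + c <= r)%N -> u k ^+ 3 <= c.+1%:R^-1.
  move=> k0 kc; rewrite (le_trans (share_cube_le _ k0 _)) //; first by nat_lia.
  by rewrite lef_pV2 ?posrE ?ltr0n // ler_nat; nat_lia.
split.
- move=> k k0 kr; rewrite tE; have := bk k k0 => h.
  rewrite (lt_le_trans (_ : 2 < beta * k%:R `^ (- ln (2 / 3)))) //; first by lra.
  by rewrite ler_eXnr // (le_trans _ (ltW h)) // ler1n.
- move=> k l k0 kl; rewrite !tE; have := bk k k0 => h.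
  have h1 : 1 <= beta * k%:R `^ (- ln (2 / 3)) by rewrite (le_trans _ (ltW h)) // ler1n.
  rewrite (le_trans (ler_weXn2l h1 kl)) // lerXn2r ?nnegrE //.
  + by rewrite (le_trans _ h1).
  + by rewrite (le_trans _ (ltW (bk l _))) //; exact: leq_trans kl.
  + rewrite ler_wpM2l //; first by rewrite (le_trans _ (ltW b4)).
    rewrite ge0_ler_powR ?nnegrE ?ler_nat //; have := oppr_ln23_ge R; lra.
- move=> k l k0 l0 klr; rewrite !tu.
  have -> : (n%:R `^ r%:R^-1) ^+ k * u k * ((n%:R `^ r%:R^-1) ^+ l * u l) =
      (n%:R `^ r%:R^-1) ^+ r * (u k * u l) by rewrite -klr exprD; ring.
  rewrite rootn_exp //.
  (* Because [u m ^ 3 <= 1 / 2 < (4 / 5) ^ 3]. Two such factors give at most 3/4, and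
     [3 n / 4 <= n - 1] for [4 <= n]. *)
  have half (m : nat) : (0 < m)%N -> (m < r)%N -> u m <= 4 / 5.
    move=> m0 mr; rewrite leNgt; apply/negP => um.
    have : (4 / 5 : R) ^+ 3 < u m ^+ 3 by rewrite ltrXn2r // nnegrE.
    have := u3 m 1%N m0; rewrite addn1 => /(_ mr); rewrite !exprS expr0; lra.
  have h1 : u k <= 4 / 5 by apply: half => //; nat_lia.
  have h2 : u l <= 4 / 5 by apply: half => //; nat_lia.
  have h3 : u k * u l <= 3 / 4.
    rewrite (le_trans (ler_pM (u0 k) (u0 l) h1 h2)) //; lra.
  have n0 : 0 <= n%:R :> R by [].
  have := ler_wpM2l n0 h3; lra.
- move=> k l m k0 l0 m0 klm; rewrite !tu.
  have -> : (n%:R `^ r%:R^-1) ^+ k * u k * ((n%:R `^ r%:R^-1) ^+ l * u l) *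
      ((n%:R `^ r%:R^-1) ^+ m * u m) =
      (n%:R `^ r%:R^-1) ^+ r * (u k * u l * u m) by rewrite -klm !exprD; ring.
  rewrite rootn_exp // ler_wpM2l //.
  (* Each part leaves at least 2 to the others, so [u ^ 3 <= 1 / 3], and the product of the cubes is
     at most [1 / 27 < 1 / 8]. *)
  rewrite leNgt; apply/negP => um.
  have : (2^-1 : R) ^+ 3 < (u k * u l * u m) ^+ 3.
    by rewrite ltrXn2r // nnegrE ?mulr_ge0.
  have hk : u k ^+ 3 <= 3^-1 by apply: (u3 k 2%N) => //; nat_lia.
  have hl : u l ^+ 3 <= 3^-1 by apply: (u3 l 2%N) => //; nat_lia.
  have hm : u m ^+ 3 <= 3^-1 by apply: (u3 m 2%N) => //; nat_lia.
  have uu0 z : 0 <= u z ^+ 3 by rewrite exprn_ge0.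
  rewrite !exprMn => h.
  have h1 := ler_pM (uu0 k) (uu0 l) hk hl.
  have h2 := ler_pM (mulr_ge0 (uu0 k) (uu0 l)) (uu0 m) h1 hm.
  move: (lt_le_trans h h2); rewrite !exprS expr0; lra.
Qed.

Definition lower_bound (R : realType) (m r : nat) : R :=
  r%:R `^ ln (2 / 3) * (m%:R `^ (r%:R^-1)) - 2 * r%:R.

Lemma lower_bound_threshold (R : realType) (m m' r k : nat) :
  (0 < k)%N -> (k <= r)%N -> threshold R m r k <= m'%:R ->
  lower_bound R m r <= lower_bound R m' k.
Proof.
move=> k0 kr; have r0 : (0 < r)%N by exact: leq_trans kr.
rewrite /threshold threshold_base // /lower_bound.
set beta := _ `^ ln (2 / 3) * _; move=> h.
have b0 : 0 <= beta by rewrite mulr_ge0 ?powR_ge0.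
have ck : k%:R `^ (- ln (2 / 3)) * k%:R `^ ln (2 / 3) = 1 :> R.
  by rewrite powRN mulVf // gt_eqF // powR_gt0 // ltr0n.
rewrite lerB //; last by rewrite ler_pM2l // ler_nat.
have -> : beta = k%:R `^ ln (2 / 3) * (beta * k%:R `^ (- ln (2 / 3))).
  by rewrite mulrCA [X in _ * X]mulrC ck mulr1.
rewrite ler_wpM2l ?powR_ge0 //.
have x0 : 0 <= beta * k%:R `^ (- ln (2 / 3)) by rewrite mulr_ge0 ?powR_ge0.
have -> : beta * k%:R `^ (- ln (2 / 3)) =
    ((beta * k%:R `^ (- ln (2 / 3))) ^+ k) `^ k%:R^-1.
  by rewrite -powR_mulrn // -powRrM divff ?powRr1 // pnatr_eq0 -lt0n.
by rewrite ge0_ler_powR ?nnegrE ?invr_ge0 ?exprn_ge0.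
Qed.

(** * The partition *)

Definition rich_pieces (R : realType) (A B : {fset set (plane R)}) (a b : R)
    (D : set (plane R)) (r : nat) : Prop :=
  exists C : 'I_r -> set (plane R),
    [/\ forall j, closed (C j), forall j, convex_set (C j),
        (\bigcup_(j in [set: 'I_r]) C j = D)%classic,
        trivIset [set: 'I_r] (fun j => (C j)°)
      & forall j, rich A (C j) a /\ rich B (C j) b].

(** The interior of a union may exceed the union of the interiors. But the part of the open set [W]
    outside the closed [C] is open and lies in [D], hence is empty, so [W] lies in the interior of
    [C]. *)
Lemma interiorU_disjoint (R : realType) (C D E : set (plane R)) :
  closed C -> (C° `&` E° = set0)%classic -> (D° `&` E° = set0)%classic ->
  ((C `|` D)° `&` E° = set0)%classic.
Proof.
move=> cC CE DE; apply/seteqP; split=> // q [CDq Eq].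
pose W := ((C `|` D)° `&` E°)%classic.
have oW : open W by apply: openI; exact: open_interior.
have WC z : W z -> C z.
  move=> Wz; apply: contrapT => nCz.
  have oWC : open (W `&` ~` C)%classic by apply: openI => //; exact: closed_openC.
  have : (D° `&` E°)%classic z.
    split; last by case: Wz.
    rewrite /interior; apply: filterS (open_nbhs_nbhs (conj oWC (conj Wz nCz))).
    by move=> y [[CDy _] nCy]; case: (interior_subset CDy).
  by rewrite DE.
have : (C° `&` E°)%classic q.
  split=> //; rewrite /interior; apply: filterS (open_nbhs_nbhs (conj oW (conj CDq Eq))).
  exact: WC.
by rewrite CE.
Qed.

Lemma rich_piecesU (R : realType) (A B : {fset set (plane R)}) (a b : R)
    (C D : set (plane R)) (k l : nat) :
  (C° `&` D° = set0)%classic ->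
  rich_pieces A B a b C k -> rich_pieces A B a b D l ->
  rich_pieces A B a b (C `|` D)%classic (k + l).
Proof.
move=> CD [F [cF vF UF tF rF]] [G [cG vG UG tG rG]].
pose H (j : 'I_(k + l)) := match fintype.split j with inl i => F i | inr i => G i end.
have Hl i : H (lshift l i) = F i.
  by rewrite /H; case: splitP => [i' /= /val_inj ->|i' /= e] //; have := ltn_ord i; nat_lia.
have Hr i : H (rshift k i) = G i.
  rewrite /H; case: splitP => [i' /= e|i' /= /addnI /val_inj ->] //.
  by have := ltn_ord i'; nat_lia.
have Hcase j : (exists2 i, j = lshift l i & H j = F i) \/
    (exists2 i, j = rshift k i & H j = G i).
  rewrite -(splitK j); case: (fintype.split j) => i /=.
    by left; exists i.
  by right; exists i.
have subC i q : (F i)° q -> C° q.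
  by apply: interiorS => z Fz; rewrite -UF; exists i.
have subD i q : (G i)° q -> D° q.
  by apply: interiorS => z Gz; rewrite -UG; exists i.
exists H; split.
- by move=> j; have [[i _ ->]|[i _ ->]] := Hcase j.
- by move=> j; have [[i _ ->]|[i _ ->]] := Hcase j.
- rewrite -UF -UG; apply/seteqP; split=> q.
    by move=> [j _]; have [[i _ ->]|[i _ ->]] := Hcase j => ?; [left|right]; exists i.
  case=> -[i _ h]; first by exists (lshift l i) => //; rewrite Hl.
  by exists (rshift k i) => //; rewrite Hr.
- move=> i j _ _ [q [hi hj]].
  have disj : C° q -> D° q -> False.
    by move=> h1 h2; have : (C° `&` D°)%classic q by []; rewrite CD.
  move: hi hj; have [[i' -> ->]|[i' -> ->]] := Hcase i;
    have [[j' -> ->]|[j' -> ->]] := Hcase j => hi hj.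
  + by congr lshift; apply: tF => //; exists q.
  + by case: disj; [exact: subC hi|exact: subD hj].
  + by case: disj; [exact: subC hj|exact: subD hi].
  + by congr rshift; apply: tG => //; exists q.
- by move=> j; have [[i _ ->]|[i _ ->]] := Hcase j.
Qed.

(** A partition of the whole plane is intersected with [D]; nothing is lost, since all crossings of
    the subfamilies lie in [D]. *)
Lemma rich_pieces_in (R : realType) (A B : {fset set (plane R)}) (a b : R)
    (D : set (plane R)) (k : nat) :
  closed D -> convex_set D -> rich_pieces A B a b setT k ->
  forall A' B', A `<=` A' -> B `<=` B' ->
  (intersection_points A `<=` D)%classic -> (intersection_points B `<=` D)%classic ->
  rich_pieces A' B' a b D k.
Proof.
move=> cD vD [C [cC vC UC tC rC]] A' B' AA' BB' AD BD.
exists (fun j => D `&` C j)%classic; split.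
- by move=> j; apply: closedI.
- by move=> j; apply: convex_setI.
- by rewrite -setI_bigcupr UC setIT.
- move=> i j _ _ [q [hi hj]]; apply: tC => //; exists q; split.
    by apply: interiorS hi => z [].
  by apply: interiorS hj => z [].
have up (L L' : {fset set (plane R)}) E c : L `<=` L' ->
    (intersection_points L `<=` D)%classic -> rich L E c -> rich L' (D `&` E)%classic c.
  move=> LL' LD [S [SL IS cS]]; exists S; split=> //.
    exact: fsubset_trans LL'.
  move=> q qS; split; last exact: IS.
  apply: LD; case: qS => l [m [lS mS lm lq mq]].
  by exists l, m; split=> //; exact: (fsubsetP SL).
by move=> j; have [h1 h2] := rC j; split; [exact: up h1|exact: up h2].
Qed.

Lemma rich_nonpos (R : realType) (A : {fset set (plane R)}) (C : set (plane R)) (a : R) :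
  a <= 0 -> rich A C a.
Proof.
move=> a0; exists fset0; split; first exact: fsub0set.
  by move=> q [l [m [/[!in_fset0]]]].
by rewrite cardfs0.
Qed.

Lemma rich_pieces_exist (R : realType) (r : nat) (A B : {fset set (plane R)}) :
  (0 < r)%N -> nice A -> nice B ->
  rich_pieces A B (lower_bound R #|` A| r) (lower_bound R #|` B| r) setT r.
Proof.
elim/ltn_ind: r A B => r IH A B r0 nA nB.
have one (A' B' : {fset set (plane R)}) (a b : R) : rich A' setT a -> rich B' setT b ->
    rich_pieces A' B' a b setT 1.
  move=> ha hb; exists (fun=> setT); split.
  - by move=> _; exact: closedT.
  - by move=> _ x y l _ _; rewrite inE.
  - by rewrite bigcup_const //; exists ord0.
  - by move=> i j _ _ _; rewrite (ord1 i) (ord1 j).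
  - by [].
have [r1|r1] := leqP r 1.
  have -> : r = 1%N by apply/eqP; rewrite eqn_leq r1 r0.
  apply: one; [exists A|exists B]; split=> //;
    by rewrite /lower_bound powR1 mul1r invr1 powRr1 // lerBlDr lerDl.
pose bA := lower_bound R #|` A| r; pose bB := lower_bound R #|` B| r.
have pos (A' B' : {fset set (plane R)}) : nice A' -> nice B' ->
    0 < lower_bound R #|` A'| r -> 0 < lower_bound R #|` B'| r ->
    rich_pieces A' B' (lower_bound R #|` A'| r) (lower_bound R #|` B'| r) setT r.
  move=> {}nA {}nB hA hB.
  have tA := thresholds_threshold r1 hA; have tB := thresholds_threshold r1 hB.
  have piece (D : set (plane R)) (k : nat) : closed D -> convex_set D -> (0 < k)%N -> (k < r)%N ->
      rich A' D (threshold R #|` A'| r k) -> rich B' D (threshold R #|` B'| r k) ->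
      rich_pieces A' B' (lower_bound R #|` A'| r) (lower_bound R #|` B'| r) D k.
    move=> cD vD k0 kr [LA [LAA IA cA]] [LB [LBB IB cB]].
    have [C [cC vC UC tC rC]] := IH k kr LA LB k0 (niceS LAA nA) (niceS LBB nB).
    apply: (rich_pieces_in cD vD _ LAA LBB IA IB); exists C; split=> // j.
    have [h1 h2] := rC j; split.
      by apply: richS h1 => //; exact: lower_bound_threshold (ltnW kr) cA.
    by apply: richS h2 => //; exact: lower_bound_threshold (ltnW kr) cB.
  have [[k [l [k0 l0 klr [u [v [c [uv A1 A2 B1 B2]]]]]]]|] := balanced_cut nA nB tA tB r1.
    have -> : [set: plane R] = (halfplane u v c `|` halfplane (- u) (- v) (- c))%classic.
      apply/seteqP; split=> // q _; case: (lerP (lin u v q) c) => h; first by left.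
      by right; rewrite /halfplane /= linN lerN2 ltW.
    rewrite -[X in rich_pieces _ _ _ _ _ X]klr; apply: rich_piecesU.
    - apply: (@line_interior _ u v c).
        by case: uv; [constructor 1|constructor 2].
      move=> q h1; rewrite /halfplane /= linN lerN2 => h2.
      by apply/eqP; rewrite eq_le h2 andbT.
    - by apply: piece => //; [exact: halfplane_closed|exact: halfplane_convex|nat_lia].
    - by apply: piece => //; [exact: halfplane_closed|exact: halfplane_convex|nat_lia].
  move=> [k [l [m [k0 l0 m0 klm [x [h [s [t [c [[s1 t1 st] [[A1 A2 A3] [B1 B2 B3]]]]]]]]]]]].
  have [d12 d13 d23] := fan_interiors c x h s t (oner_neq0 R).
  have cl a b y z : closed (wedge a b y h z).
    by rewrite wedge_setI; apply: closedI; exact: halfplane_closed.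
  have vx a b y z : convex_set (wedge a b y h z).
    by rewrite wedge_setI; apply: convex_setI; exact: halfplane_convex.
  have -> : [set: plane R] = (wedge 1 c x h s `|`
      wedge (- 1) (- c) (- x) h t `|` top 1 c x h s t)%classic.
    apply/seteqP; split=> // q _.
    by have [] := fan_cover_plane 1 c x h q s1 t1 st; [left; left|left; right|right].
  rewrite -[X in rich_pieces _ _ _ _ _ X]klm; apply: rich_piecesU.
  - exact: interiorU_disjoint.
  - apply: rich_piecesU => //; apply: piece => //; nat_lia.
  - apply: piece => //; last by nat_lia.
      by rewrite top_setI; apply: closedI; exact: halfplane_closed.
    by rewrite top_setI; apply: convex_setI; exact: halfplane_convex.
have [hA|hA] := lerP bA 0; have [hB|hB] := lerP bB 0; last exact: pos.
- exists (fun j : 'I_r => if (j == 0 :> nat)%N then setT else set0); split.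
  + by move=> j; case: ifP => _; [exact: closedT|exact: closed0].
  + by move=> j x y l; case: ifP => _; rewrite !inE.
  + by apply/seteqP; split=> // q _; exists (Ordinal r0).
  + move=> i j _ _ [q []]; case: ifP => [/eqP i0|_]; last by rewrite interior0.
    by case: ifP => [/eqP j0|_]; [move=> _ _; apply/val_inj; rewrite /= i0 j0|rewrite interior0].
  + by move=> j; split; exact: rich_nonpos.
(* [A] asks for nothing here, so [B] takes its place as well. *)
- have [C [cC vC UC tC rC]] := pos B B nB nB hB hB.
  exists C; split=> // j; split; first exact: rich_nonpos.
  by have [] := rC j.
- have [C [cC vC UC tC rC]] := pos A A nA nA hA hA.
  exists C; split=> // j; split; last exact: rich_nonpos.
  by have [] := rC j.
Qed.

Theorem theorem1p3 (R : realType) (A B : {fset set (plane R)}) (r : nat)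
    (hA : line_set A) (hB : line_set B)
    (hAB : general_position (A `|` B)%fset) (hr : (0 < r)%N) :
  exists C : 'I_r -> set (plane R),
    convex_partition C /\
    forall j : 'I_r, exists Aj Bj : {fset set (plane R)},
      [/\ (Aj `<=` A)%fset, (Bj `<=` B)%fset,
          (intersection_points Aj `<=` C j)%classic
        & (intersection_points Bj `<=` C j)%classic] /\
      (r%:R `^ ln (2 / 3) * (#|` A|%:R `^ (r%:R^-1)) - 2 * r%:R
           <= #|` Aj|%:R :> R) /\
      (r%:R `^ ln (2 / 3) * (#|` B|%:R `^ (r%:R^-1)) - 2 * r%:R
           <= #|` Bj|%:R :> R).
Proof.
have nAB : nice (A `|` B).
  case: hAB => npar conc _; split=> // l.
  by rewrite inE => /orP[/hA|/hB].
have nA : nice A by exact: niceS (fsubsetUl _ _) nAB.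
have nB : nice B by exact: niceS (fsubsetUr _ _) nAB.
have [C [cC vC UC tC rC]] := rich_pieces_exist hr nA nB.
exists C; split=> // j.
have [[Aj [AjA IA cA]] [Bj [BjB IB cB]]] := rC j.
by exists Aj, Bj.
Qed.
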